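(* Let $v,w\in I(d,n)$ with $v\le w$. Let $X_w$ be the Schubert variety in the Grassmannian $G_{d,n}$ corresponding to $w$, let $e^v\in X_w$ be the $T$-fixed point corresponding to $v$, and let $R=\mathrm{gr}_{\mathfrak M}(\mathcal O_{X_w,e^v})$ be the coordinate ring of the tangent cone to $X_w$ at $e^v$, i.e. the associated graded ring of the local ring $\mathcal O_{X_w,e^v}$ with respect to its maximal ideal $\mathfrak M$. Then for every $m\ge 0$ the vector space dimension of the $m$-th graded piece $R(m)$ of $R$ equals the cardinality of $S^v_w(m)$, the set of $w$-dominated monomials of degree $m$ in $\mathfrak R^v$.
   Context: Fix positive integers $d\le n$ and let $k$ be the underlying field. $I(d,n)$ is the set of $d$-element subsets of $\{1,\dots,n\}$, written $v=(v_1<\dots<v_d)$, with partial order $v\le w$ iff $v_i\le w_i$ for all $i$. Geometry: $G_{d,n}$ is the Grassmannian of $d$-dimensional subspaces of $k^n$ (column vectors), on which $GL_n$ acts by left multiplication; $B\subset GL_n$ is the subgroup of invertible upper triangular matrices and $T$ the subgroup of invertible diagonal matrices. For $v\in I(d,n)$, $e^v$ is the point of $G_{d,n}$ given by the span of the standard basis vectors $e_{v_1},\dots,e_{v_d}$. For $w\in I(d,n)$, $X_w$ is the closure of the $B$-orbit of $e^w$, with the reduced scheme structure. One has $e^v\in X_w$ iff $v\le w$. Combinatorics: for $v\in I(d,n)$, $\mathfrak R^v=\{(r,c): r\in\{1,\dots,n\}\setminus v,\ c\in v\}$ and $\mathfrak N^v=\{(r,c)\in\mathfrak R^v: r>c\}$.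 A monomial in a set is a finite multiset of elements of that set; its degree is its cardinality counted with multiplicity. For $\beta_1=(r_1,c_1),\beta_2=(r_2,c_2)$ in $\mathfrak N^v$, write $\beta_1>\beta_2$ if $r_1>r_2$ and $c_1<c_2$. A $v$-chain is a (possibly empty) sequence $\beta_1>\dots>\beta_t$ of elements of $\mathfrak N^v$. For a $v$-chain with $\beta_i=(r_i,c_i)$, put $s_{\beta_1}\cdots s_{\beta_t}v=(v\setminus\{c_1,\dots,c_t\})\cup\{r_1,\dots,r_t\}\in I(d,n)$ (equal to $v$ if the chain is empty). $w\in I(d,n)$ dominates the $v$-chain if $w\ge s_{\beta_1}\cdots s_{\beta_t}v$. A $v$-chain in a monomial $\mathfrak S$ in $\mathfrak R^v$ is a $v$-chain all of whose elements belong to $\mathfrak S\cap\mathfrak N^v$. $w$ dominates $\mathfrak S$ ($\mathfrak S$ is $w$-dominated) if $w$ dominates every $v$-chain in $\mathfrak S$. *)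

(* Defs.v *)
From HB Require Import structures.
From mathcomp Require Import all_boot all_order all_algebra.
From mathcomp Require Import boolp.
From mathcomp Require Import mpoly.
From mathcomp Require Import ring.

Set Implicit Arguments.
Unset Strict Implicit.
Unset Printing Implicit Defensive.

Import GRing.Theory.
Local Open Scope ring_scope.
Local Open Scope quotient_scope.

(** The ground set {1, .., n} is rendered as 'I_n = {0, .., n-1}; the shift by
    one affects none of the (purely order-theoretic) notions below. *)
Definition Idn (d n : nat) := {u : {set 'I_n} | #|u| == d}.
HB.instance Definition _ d n := Finite.on (Idn d n).

Coercion Idn_set d n (u : Idn d n) : {set 'I_n} := val u.

(** The j-th element of u: enumerations of subsets of 'I_n are increasing. *)
Definition elt d n (u : Idn d n) (j : 'I_d) : 'I_n :=
  enum_val (cast_ord (esym (eqP (valP u))) j).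

(** Componentwise comparison of the increasing enumerations; this is false for
    sets of different cardinalities. *)
Definition set_le n (A B : {set 'I_n}) : bool :=
  all2 leq [seq val i | i <- enum A] [seq val i | i <- enum B].

Definition Rset n (v : {set 'I_n}) : {set 'I_n * 'I_n} :=
  [set b | (b.1 \notin v) && (b.2 \in v)].

Definition Nset n (v : {set 'I_n}) : {set 'I_n * 'I_n} :=
  [set b in Rset v | (b.2 < b.1)%N].

Definition root_gt n : rel ('I_n * 'I_n) :=
  [rel b1 b2 : 'I_n * 'I_n | (b2.1 < b1.1)%N && (b1.2 < b2.2)%N].

Definition is_chain n (v : {set 'I_n}) (s : seq ('I_n * 'I_n)) : bool :=
  all (mem (Nset v)) s && sorted (@root_gt n) s.

Definition reflect_chain n (v : {set 'I_n}) (s : seq ('I_n * 'I_n)) :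
    {set 'I_n} :=
  (v :\: [set c in [seq b.2 | b <- s]]) :|: [set r in [seq b.1 | b <- s]].

Definition dominates_chain n (v w : {set 'I_n}) (s : seq ('I_n * 'I_n)) : bool :=
  set_le (reflect_chain v s) w.

(** A finite multiset of pairs, given by its multiplicity function. *)
Definition monomial n := {ffun 'I_n * 'I_n -> nat}.

Definition mon_support n (S : monomial n) : {set 'I_n * 'I_n} :=
  [set b | S b != 0%N].

Definition mon_degree n (S : monomial n) : nat := (\sum_b S b)%N.

Definition dominates n (v w : {set 'I_n}) (S : monomial n) : Prop :=
  forall s, is_chain v s -> all (mem (mon_support S)) s ->
    dominates_chain v w s.

(** In a monomial of degree m every multiplicity is at most m, so bounding the
    multiplicities by m loses nothing and makes the set manifestly finite. *)
Definition Svw n (v w : {set 'I_n}) (m : nat) :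
    {set {ffun 'I_n * 'I_n -> 'I_m.+1}} :=
  [set S : {ffun 'I_n * 'I_n -> 'I_m.+1} |
     let M : monomial n := [ffun b => val (S b)] in
     [&& mon_support M \subset Rset v, mon_degree M == m
       & `[< dominates v w M >] ] ].

(** For a local ring this is its maximal ideal. *)
Definition nonunits (A : comPzRingType) (x : A) : Prop :=
  ~ exists y, x * y = 1.

Fixpoint ideal_pow (A : comPzRingType) (M : A -> Prop) (m : nat) : A -> Prop :=
  if m is m'.+1 then
    fun x => exists s : seq (A * A),
      (forall p, p \in s -> M p.1 /\ ideal_pow M m' p.2) /\
      x = \sum_(p <- s) p.1 * p.2
  else fun=> True.

(** For subspaces B of A, the quotient A / B has dimension N: the classes of
    some b_0, .., b_(N-1) in A form a basis of it. *)
Definition quotient_dim (k : fieldType) (V : lmodType k) (A B : V -> Prop)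
    (N : nat) : Prop :=
  exists b : 'I_N -> V, (forall i, A (b i)) /\
    forall x, A x -> exists! c : 'rV[k]_N, B (x - \sum_i c 0 i *: b i).

(** The base field k is arbitrary.  A point of a k-scheme is represented by a
    K-point for some field extension iota : k -> K, so that a subset of the
    Grassmannian is a family of sets of K-points; this is what makes "closure
    of the B-orbit" meaningful even when k is finite. *)

Definition coord_space (K : fieldType) n (u : {set 'I_n}) : {vspace 'cV[K]_n} :=
  <<[seq delta_mx i ord0 | i <- enum u]>>%VS.

Definition upper_triangular_unit (K : fieldType) n (b : 'M[K]_n) : bool :=
  (b \in unitmx) && is_trig_mx b^T.

Definition Borel_orbit (K : fieldType) n (w : {set 'I_n})
    (U : {vspace 'cV[K]_n}) : Prop :=
  exists2 b : 'M[K]_n, upper_triangular_unit b &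
    U = (linfun (mulmx b) @: coord_space K w)%VS.

(** The Pluecker coordinates of U, computed in the chosen basis [vbasis U];
    another basis multiplies all of them by a common nonzero scalar, so they
    are only used to test whether homogeneous polynomials vanish. *)
Definition plucker (K : fieldType) d n (U : {vspace 'cV[K]_n}) (u : Idn d n) : K :=
  \det (\matrix_(i < d, j < d) (vbasis U)`_j (elt u i) ord0).

(** The homogeneous coordinate ring of the projective space containing the
    Grassmannian, with one variable for each element of I(d, n). *)
Notation plucker_poly k d n := {mpoly k[#|{: Idn d n}|]}.

Definition plucker_eval (k K : fieldType) (iota : k -> K) d n
    (U : {vspace 'cV[K]_n}) (P : plucker_poly k d n) : K :=
  mmap iota (fun i => plucker U (enum_val i : Idn d n)) P.

(** K-points of the Zariski closure, in the Grassmannian, of the Borel orbit of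
    e^w: the Zariski closed subsets are cut out by homogeneous polynomials in
    the Pluecker coordinates. *)
Definition Schubert (k : fieldType) d n (w : Idn d n)
    (K : fieldType) (iota : {rmorphism k -> K}) (U : {vspace 'cV[K]_n}) : Prop :=
  \dim U = d /\
  forall (e : nat) (P : plucker_poly k d n), P \is e.-homog ->
    (forall (L : fieldType) (jota : {rmorphism k -> L}) (V : {vspace 'cV[L]_n}),
        Borel_orbit w V -> plucker_eval jota V P = 0) ->
    plucker_eval iota U P = 0.

Definition vanishes_on_Schubert (k : fieldType) d n (w : Idn d n)
    (P : plucker_poly k d n) : Prop :=
  forall (K : fieldType) (iota : {rmorphism k -> K}) (U : {vspace 'cV[K]_n}),
    Schubert w iota U -> plucker_eval iota U P = 0.

Section LocalRing.
Variables (k : fieldType) (d n : nat) (v w : Idn d n).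
Local Notation S := (plucker_poly k d n).

Definition value_at_ev (P : S) : k := plucker_eval idfun (coord_space k v) P.

Definition denominator (Q : S) : Prop :=
  (exists e, Q \is e.-homog) /\ value_at_ev Q != 0.

(** Fractions P / Q of homogeneous polynomials of the same degree with
    Q (e^v) != 0. *)
Definition is_fraction (x : S * S) : bool :=
  `[< exists e, x.1 \is e.-homog /\ x.2 \is e.-homog >]
  && (value_at_ev x.2 != 0).

Definition fraction := {x : S * S | is_fraction x}.
HB.instance Definition _ := Choice.on fraction.

(** Equality of fractions as germs at e^v of functions on the reduced scheme
    X_w: equality after restriction to some neighbourhood {s != 0} of e^v. *)
Definition same_germ (x y : fraction) : bool :=
  `[< exists2 s, denominator s &
      vanishes_on_Schubert w
        (s * ((val x).1 * (val y).2 - (val y).1 * (val x).2)) >].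

Lemma plucker_evalD (K : fieldType) (iota : {rmorphism k -> K}) U (P Q : S) :
  plucker_eval iota U (P + Q) = plucker_eval iota U P + plucker_eval iota U Q.
Proof. exact: raddfD. Qed.

Lemma plucker_evalM (K : fieldType) (iota : {rmorphism k -> K}) U (P Q : S) :
  plucker_eval iota U (P * Q) = plucker_eval iota U P * plucker_eval iota U Q.
Proof. exact: rmorphM. Qed.

Lemma plucker_eval1 (K : fieldType) (iota : {rmorphism k -> K}) U :
  plucker_eval iota U (1 : S) = 1.
Proof. exact: rmorph1. Qed.

Lemma plucker_eval0 (K : fieldType) (iota : {rmorphism k -> K}) U :
  plucker_eval iota U (0 : S) = 0.
Proof. exact: raddf0. Qed.

Lemma vanishesD (P Q : S) : vanishes_on_Schubert w P ->
  vanishes_on_Schubert w Q -> vanishes_on_Schubert w (P + Q).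
Proof.
move=> hP hQ K iota U hU.
by rewrite plucker_evalD hP // hQ // addr0.
Qed.

Lemma vanishesMl (P Q : S) :
  vanishes_on_Schubert w Q -> vanishes_on_Schubert w (P * Q).
Proof. by move=> hQ K iota U hU; rewrite plucker_evalM hQ // mulr0. Qed.

Lemma vanishes0 : vanishes_on_Schubert w (0 : S).
Proof. by move=> K iota U _; rewrite plucker_eval0. Qed.

Lemma homog1 : (1 : S) \is 0.-homog.
Proof. exact: dhomog1. Qed.

Lemma denominator1 : denominator 1.
Proof.
by split; [exists 0%N; exact: homog1 | rewrite /value_at_ev plucker_eval1 oner_neq0].
Qed.

Lemma denominatorM P Q : denominator P -> denominator Q -> denominator (P * Q).
Proof.
move=> [[e he] nP] [[f hf] nQ]; split.
  by exists (e + f)%N; exact: dhomogM.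
by rewrite /value_at_ev plucker_evalM mulf_neq0.
Qed.

Lemma fraction_denominator (x : fraction) : denominator (val x).2.
Proof.
case: x => [[P Q]] /= /andP[/asboolP[e [_ hQ]] nQ].
by split=> //; exists e.
Qed.

Lemma same_germ_equiv : equiv_class_of same_germ.
Proof.
split=> [x|x y|y x z].
- apply/asboolP; exists 1; first exact: denominator1.
  by rewrite subrr mulr0; exact: vanishes0.
- apply: asbool_equiv_eq; split=> -[s hs h]; exists s => //.
    have := vanishesMl (-1) h; congr (vanishes_on_Schubert w _); ring.
  have := vanishesMl (-1) h; congr (vanishes_on_Schubert w _); ring.
- move=> /asboolP[s hs h] /asboolP[t ht h']; apply/asboolP.
  exists (s * t * (val y).2).
    by do 2?apply: denominatorM => //; exact: fraction_denominator.
  have := vanishesD (vanishesMl (t * (val z).2) h)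
                    (vanishesMl (s * (val x).2) h').
  congr (vanishes_on_Schubert w _); ring.
Qed.

Canonical same_germ_equivRel := EquivRelPack same_germ_equiv.

Definition local_ring := {eq_quot same_germ}.
HB.instance Definition _ := EqQuotient.on local_ring.
HB.instance Definition _ := Choice.on local_ring.

Local Notation "\germ x" := (\pi_local_ring x) (at level 10, x at level 9).

Lemma germ_eq (x y : fraction) :
  (val x).1 * (val y).2 = (val y).1 * (val x).2 -> \germ x = \germ y.
Proof.
move=> h; apply/eqmodP/asboolP; exists 1; first exact: denominator1.
by rewrite h subrr mulr0; exact: vanishes0.
Qed.

Lemma is_fraction_zero : is_fraction (0, 1).
Proof.
apply/andP; split=> /=; last by have [] := denominator1.
by apply/asboolP; exists 0%N; rewrite homog1 rpred0.
Qed.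

Lemma is_fraction_one : is_fraction (1, 1).
Proof.
apply/andP; split=> /=; last by have [] := denominator1.
by apply/asboolP; exists 0%N; rewrite homog1.
Qed.

Lemma is_fraction_add (x y : fraction) : is_fraction
  ((val x).1 * (val y).2 + (val y).1 * (val x).2, (val x).2 * (val y).2).
Proof.
case: x y => [[P Q] /= /andP[/asboolP[e [/= hP hQ]] nQ]].
case=> [[P' Q'] /= /andP[/asboolP[f [/= hP' hQ']] nQ']].
apply/andP; split; last by rewrite /value_at_ev plucker_evalM mulf_neq0.
apply/asboolP; exists (e + f)%N; split=> /=; last exact: dhomogM.
by apply: rpredD; [|rewrite addnC]; apply: dhomogM.
Qed.

Lemma is_fraction_mul (x y : fraction) : is_fraction
  ((val x).1 * (val y).1, (val x).2 * (val y).2).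
Proof.
case: x y => [[P Q] /= /andP[/asboolP[e [/= hP hQ]] nQ]].
case=> [[P' Q'] /= /andP[/asboolP[f [/= hP' hQ']] nQ']].
apply/andP; split; last by rewrite /value_at_ev plucker_evalM mulf_neq0.
by apply/asboolP; exists (e + f)%N; split; exact: dhomogM.
Qed.

Lemma is_fraction_scale (a : k) (x : fraction) :
  is_fraction (a *: (val x).1, (val x).2).
Proof.
case: x => [[P Q] /= /andP[/asboolP[e [/= hP hQ]] nQ]].
apply/andP; split=> //.
by apply/asboolP; exists e; split=> //=; exact: rpredZ.
Qed.

Definition fraction_zero : fraction := exist is_fraction _ is_fraction_zero.
Definition fraction_one : fraction := exist is_fraction _ is_fraction_one.
Definition fraction_add x y : fraction := exist is_fraction _ (is_fraction_add x y).
Definition fraction_mul x y : fraction := exist is_fraction _ (is_fraction_mul x y).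
Definition fraction_scale a x : fraction := exist is_fraction _ (is_fraction_scale a x).

Definition germ_add := lift_op2 local_ring fraction_add.
Definition germ_mul := lift_op2 local_ring fraction_mul.
Definition germ_scale (a : k) := lift_op1 local_ring (fraction_scale a).
Definition germ_opp (x : local_ring) : local_ring := germ_scale (-1) x.

Lemma repr_germ (x : fraction) : exists2 s, denominator s &
  vanishes_on_Schubert w
    (s * ((val x).1 * (val (repr (\germ x))).2
          - (val (repr (\germ x))).1 * (val x).2)).
Proof.
apply/(@asboolP (exists2 s, _ & _)); rewrite -/(same_germ x (repr (\germ x))).
by have /eqmodP : \germ x = \germ (repr (\germ x)) by rewrite reprK.
Qed.

Lemma germ_addE x y :
  germ_add (\germ x) (\germ y) = \germ (fraction_add x y).
Proof.
rewrite /germ_add; unlock; apply/esym/eqmodP/asboolP => /=.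
have [s hs h] := repr_germ x; have [t ht h'] := repr_germ y.
exists (s * t); first exact: denominatorM.
move: (repr (\germ x)) (repr (\germ y)) h h' => x' y' h h'.
have := vanishesD (vanishesMl (t * (val y).2 * (val y').2) h)
                  (vanishesMl (s * (val x).2 * (val x').2) h').
congr (vanishes_on_Schubert w _); ring.
Qed.

Lemma germ_mulE x y :
  germ_mul (\germ x) (\germ y) = \germ (fraction_mul x y).
Proof.
rewrite /germ_mul; unlock; apply/esym/eqmodP/asboolP => /=.
have [s hs h] := repr_germ x; have [t ht h'] := repr_germ y.
exists (s * t); first exact: denominatorM.
move: (repr (\germ x)) (repr (\germ y)) h h' => x' y' h h'.
have := vanishesD (vanishesMl (t * (val y).1 * (val y').2) h)
                  (vanishesMl (s * (val x').1 * (val x).2) h').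
congr (vanishes_on_Schubert w _); ring.
Qed.

Lemma germ_scaleE a x :
  germ_scale a (\germ x) = \germ (fraction_scale a x).
Proof.
rewrite /germ_scale; unlock; apply/esym/eqmodP/asboolP => /=.
have [s hs h] := repr_germ x; exists s => //.
move: (repr (\germ x)) h => x' h; have := vanishesMl (a%:MP) h.
by congr (vanishes_on_Schubert w _); rewrite -!mul_mpolyC; ring.
Qed.

Fact germ_addA : associative germ_add.
Proof.
elim/quotW=> x; elim/quotW=> y; elim/quotW=> z.
by rewrite !germ_addE; apply: germ_eq => /=; ring.
Qed.

Fact germ_addC : commutative germ_add.
Proof.
elim/quotW=> x; elim/quotW=> y.
by rewrite !germ_addE; apply: germ_eq => /=; ring.
Qed.

Fact germ_add0 : left_id (\germ fraction_zero) germ_add.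
Proof.
by elim/quotW=> x; rewrite !germ_addE; apply: germ_eq => /=; ring.
Qed.

Fact germ_addN : left_inverse (\germ fraction_zero) germ_opp germ_add.
Proof.
elim/quotW=> x; rewrite /germ_opp germ_scaleE germ_addE.
by apply: germ_eq => /=; rewrite scaleN1r; ring.
Qed.

HB.instance Definition _ :=
  GRing.isZmodule.Build local_ring germ_addA germ_addC germ_add0 germ_addN.

Fact germ_mulA : associative germ_mul.
Proof.
elim/quotW=> x; elim/quotW=> y; elim/quotW=> z.
by rewrite !germ_mulE; apply: germ_eq => /=; ring.
Qed.

Fact germ_mulC : commutative germ_mul.
Proof.
elim/quotW=> x; elim/quotW=> y.
by rewrite !germ_mulE; apply: germ_eq => /=; ring.
Qed.

Fact germ_mul1 : left_id (\germ fraction_one) germ_mul.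
Proof.
by elim/quotW=> x; rewrite !germ_mulE; apply: germ_eq => /=; ring.
Qed.

Fact germ_mulDl : left_distributive germ_mul germ_add.
Proof.
elim/quotW=> x; elim/quotW=> y; elim/quotW=> z.
by rewrite !(germ_mulE, germ_addE); apply: germ_eq => /=; ring.
Qed.

HB.instance Definition _ := GRing.Zmodule_isComPzRing.Build local_ring
  germ_mulA germ_mulC germ_mul1 germ_mulDl.

Fact germ_scaleA a b x : germ_scale a (germ_scale b x) = germ_scale (a * b) x.
Proof.
by elim/quotW: x => x; rewrite !germ_scaleE; congr (\germ _); apply: val_inj;
   rewrite /= scalerA.
Qed.

Fact germ_scale1 : left_id 1 germ_scale.
Proof.
by elim/quotW=> x; rewrite germ_scaleE; apply: germ_eq; rewrite /= scale1r.
Qed.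

Fact germ_scaleDr : right_distributive germ_scale +%R.
Proof.
move=> a; elim/quotW=> x; elim/quotW=> y.
change (germ_scale a (germ_add (\germ x) (\germ y))
  = germ_add (germ_scale a (\germ x)) (germ_scale a (\germ y))).
rewrite !(germ_scaleE, germ_addE); apply: germ_eq => /=.
by rewrite -!mul_mpolyC; ring.
Qed.

Fact germ_scaleDl x : {morph germ_scale^~ x : a b / a + b}.
Proof.
move=> a b; elim/quotW: x => x.
change (germ_scale (a + b) (\germ x)
  = germ_add (germ_scale a (\germ x)) (germ_scale b (\germ x))).
rewrite !(germ_scaleE, germ_addE); apply: germ_eq => /=.
by rewrite -!mul_mpolyC mpolyCD; ring.
Qed.

HB.instance Definition _ := GRing.Zmodule_isLmodule.Build k local_ring
  germ_scaleA germ_scale1 germ_scaleDr germ_scaleDl.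

End LocalRing.

(** The m-th graded piece M^m / M^(m+1) of gr_M O has dimension N over k,
    where M is the maximal ideal of the local ring O of X_w at e^v. *)
Definition tangent_cone_piece_dim (k : fieldType) d n (v w : Idn d n)
    (m N : nat) : Prop :=
  let M := @nonunits (local_ring k v w) in
  quotient_dim (ideal_pow M m) (ideal_pow M m.+1) N.

(* Main.v *)
Require Import Defs.
From HB Require Import structures.
From mathcomp Require Import all_boot all_order all_algebra.
From mathcomp Require Import fingroup perm generic_quotient boolp mpoly ring zify.

(** The affine chart of the Grassmannian around [e^v] has coordinates [x_rc],
    [(r, c)] in [Rset v], and in it [X_w] is a cone, so the graded pieces of its
    tangent cone are the homogeneous pieces of the coordinate ring of
    [X_w] in the chart.  The dominated monomials form a basis of this ring.

    They span: a monomial that is not dominated contains a chain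
    [(r_1, c_1) > .. > (r_t, c_t)] too long for the rank conditions on [X_w], so
    the minor with rows [r_i] and columns [c_j] vanishes on [X_w]; this expresses
    the product of the [x_(r_i, c_i)], hence the monomial, by monomials of
    smaller weight.

    They are independent, even on the Borel orbit of [e^w] over an infinite
    field.  The proof moves [v] and [w] upwards by a simple transposition
    [s = (i, i+1)] with [i] in [v] and [i+1] not in [v], until [v = w] is the
    last subset, when the orbit is the whole chart.  If [s w <= w], then [X_w] is
    [s]-stable and the charts at [v] and [s v] are exchanged by [s].  Otherwise let
    [y = x_(i+1, i)] and write a relation as [sum_j y^j f_j].  In the chart at
    [s v] its top coefficient, if of positive degree in [y], is a relation between
    dominated monomials for [(s v, w)]; and a relation without [y] holds on
    [X_(s w)], the closure of the [y]-translates of [X_w]. *)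

Set Implicit Arguments.
Unset Strict Implicit.
Unset Printing Implicit Defensive.
Import GRing.Theory.

(** * Dominance through counts *)

Section SetOrder.
Variable n : nat.
Implicit Types (A B v w : {set 'I_n}) (k : nat) (S : monomial n).

(** Counting the elements from each threshold on turns the componentwise order on sets of equal size
    into numerical inequalities, which are easy to follow when single elements are exchanged. *)
Definition above A k : nat := \sum_(a in A) (k <= a).

Lemma above_count A k : above A k = count (leq k) [seq val i | i <- enum A].
Proof.
rewrite /above count_map -sum1_count big_enum_cond /= big_mkcondr /=.
by apply: eq_bigr => a _; case: leq.
Qed.

Lemma all2_leq_count (s t : seq nat) k :
  all2 leq s t -> count (leq k) s <= count (leq k) t.
Proof.
elim: s t => [|a s IHs] [|b t] //= /andP[le_ab /IHs le_st].
by rewrite leq_add //; case: (leqP k a) => // le_ka; rewrite (leq_trans le_ka le_ab).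
Qed.

(** Induction on the lists. At threshold [a] the whole first list is counted, hence so is the whole
    second list, and [a <= b]. For [a < k <= b] the tail of the second list is counted entirely; for
    all other [k] both heads contribute equally. *)
Lemma count_all2_leq (s t : seq nat) : sorted leq s -> sorted leq t ->
  size s = size t -> (forall k, count (leq k) s <= count (leq k) t) ->
  all2 leq s t.
Proof.
elim: s t => [|a s IHs] [|b t] //= ss st [sz] H.
have alls : all (leq a) s by rewrite order_path_min //; apply: leq_trans.
have allt : all (leq b) t by rewrite order_path_min //; apply: leq_trans.
have le_ab : a <= b.
  have := H a; rewrite leqnn add1n (eqP (etrans (esym (all_count _ _)) alls)).
  by have := count_size (leq a) t; case: (leqP a b) => // _; lia.
rewrite le_ab /=; apply: IHs => //; [exact: path_sorted ss|exact: path_sorted st|].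
move=> k; have := H k.
case: (leqP k a) => [le_ka|lt_ak]; first by rewrite (leq_trans le_ka le_ab) !add1n.
case: (leqP k b) => // le_kb _.
have /eqP -> : count (leq k) t == size t.
  by rewrite -all_count; apply: sub_all allt => x; apply: leq_trans.
by rewrite -sz count_size.
Qed.

Lemma set_leP A B : #|A| = #|B| ->
  reflect (forall k, above A k <= above B k) (set_le A B).
Proof.
have sortE (C : {set 'I_n}) : sorted leq [seq val i | i <- enum C].
  rewrite sorted_map /enum_mem; apply: sorted_filter; first by move=> y x z; apply: leq_trans.
  by have := iota_sorted 0 n; rewrite -val_enum_ord sorted_map enumT.
move=> eqAB; apply: (iffP idP) => [leAB k|leAB].
  by rewrite !above_count all2_leq_count.
apply: count_all2_leq; rewrite ?sortE // ?size_map -?cardE //.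
by move=> k; have := leAB k; rewrite !above_count.
Qed.

Lemma above0 A : above A 0 = #|A|.
Proof. by rewrite /above sum1_card. Qed.

Lemma aboveS A (a : 'I_n) : above A a = (a \in A) + above A a.+1.
Proof.
rewrite /above; case aA: (a \in A); last first.
  rewrite add0n; apply: eq_bigr => b bA; rewrite (ltn_neqAle a).
  by case: eqP => // /val_inj ab; rewrite -ab aA in bA.
rewrite !(bigD1 a aA) /= leqnn ltnn add0n; congr addn; apply: eq_bigr => b /andP[_ ba].
by rewrite (ltn_neqAle a) -[_ == _ :> nat]/(a == b) eq_sym ba.
Qed.

Definition straddles k (b : 'I_n * 'I_n) : bool := b.2 < k <= b.1.

(* The elements of a chain that straddle [k] form a chain again, and by
   [above_chain] only these contribute to [above (reflect_chain v s) k]; hence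
   dominance reduces to this condition, see [dominatesP]. *)
Definition chain_bounded v w S : Prop := forall k s,
  sorted (@root_gt n) s -> all (mem (mon_support S)) s ->
  all (straddles k) s -> size s + above v k <= above w k.

Lemma root_gt_trans : transitive (@root_gt n).
Proof. by move=> b a c /andP[h1 h2] /andP[h3 h4]; apply/andP; lia. Qed.

(** A chain removes distinct elements [b.2] of [v] and adds distinct elements [b.1] outside [v],
    each larger than its partner; so exactly the pairs with [b.2 < k <= b.1] raise the count. *)
Lemma above_chain v s k : is_chain v s ->
  above (reflect_chain v s) k = above v k + count (straddles k) s.
Proof.
case/andP => /allP sN ss.
have sR b : b \in s -> [/\ b.1 \notin v, b.2 \in v & b.2 < b.1].
  by move=> /sN; rewrite !inE => /andP[/andP[-> ->] ->].
have uc : uniq [seq b.2 | b <- s].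
  apply: (@sorted_uniq _ (fun a b : 'I_n => a < b)) => [x y z|x|].
  - exact: ltn_trans.
  - by rewrite ltnn.
  - by rewrite sorted_map; apply: sub_sorted ss => a b /andP[].
have ur : uniq [seq b.1 | b <- s].
  apply: (@sorted_uniq _ (fun a b : 'I_n => b < a)) => [x y z h1 h2|x|].
  - exact: ltn_trans h2 h1.
  - by rewrite ltnn.
  - by rewrite sorted_map; apply: sub_sorted ss => a b /andP[].
rewrite /above /reflect_chain.
rewrite (bigID (mem v)) /= (eq_bigl (mem (v :\: [set c in [seq b.2 | b <- s]]))); last first.
  move=> a /=; rewrite !inE; case av: (a \in v); rewrite ?andbF // ?andbT.
  case: (boolP (a \in [seq b.1 | b <- s])) => //; last by rewrite orbF.
  by case/mapP => b /sR[+ _ _] ab; rewrite -ab av.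
rewrite [X in _ + X](eq_bigl (mem [set r in [seq b.1 | b <- s]])); last first.
  move=> a /=; rewrite !inE; case av: (a \in v); rewrite ?andbF // ?andbT //.
  by case: (boolP (a \in [seq b.1 | b <- s])) => // /mapP[b /sR[+ _ _] ab]; rewrite -ab av.
rewrite [X in _ = X + _](bigID (mem [set c in [seq b.2 | b <- s]])) /=.
rewrite [X in _ = X + _ + _](eq_bigl (mem [set c in [seq b.2 | b <- s]])); last first.
  move=> a /=; rewrite !inE andbC; case: (boolP (a \in [seq b.2 | b <- s])) => //.
  by case/mapP => b /sR[_ + _] ->.
rewrite [X in X + _](eq_bigl (fun a => (a \in v) && (a \notin [set c in [seq b.2 | b <- s]]))); last first.
  by move=> a; rewrite !inE andbC.
have sumE (t : seq 'I_n) : uniq t -> \sum_(i in [set x in t]) (k <= i) = \sum_(i <- t) (k <= i).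
  by move=> ut; rewrite big_uniq //=; apply: eq_bigl => a; rewrite inE.
rewrite !sumE // !big_map.
have -> : \sum_(b <- s) (k <= b.1) = \sum_(b <- s) (k <= b.2) + count (straddles k) s.
  rewrite -sum1_count [X in _ = _ + X]big_mkcond /= -big_split /=.
  rewrite !big_seq; apply: eq_bigr => b /sR[_ _]; rewrite /straddles => lt_b.
  by case: (leqP k b.1); case: (leqP k b.2) => //; lia.
by rewrite addnCA addnA.
Qed.
End SetOrder.

Section Dominance.
Variables (d n : nat) (v w : {set 'I_n}).
Hypotheses (v_card : #|v| = d) (w_card : #|w| = d).
Implicit Types S : monomial n.

Lemma card_reflect_chain s : is_chain v s -> #|reflect_chain v s| = d.
Proof.
move=> chs; rewrite -above0 above_chain // above0 v_card.
have -> : count (straddles 0) s = 0; last by rewrite addn0.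
by apply/eqP; rewrite -leqn0 leqNgt -has_count; apply/negP => /hasP[b _]; rewrite /straddles ltn0.
Qed.

Lemma dominatesP S : mon_support S \subset Rset v ->
  dominates v w S <-> chain_bounded v w S.
Proof.
move=> /subsetP SR; split=> [domS k s ss sS sk | bndS s chs sS].
  have chs : is_chain v s.
    rewrite /is_chain ss andbT; apply/allP => b bs.
    have bR := SR _ (allP sS _ bs); have /andP[bk kb] := allP sk _ bs.
    by rewrite /= inE bR (leq_trans bk kb).
  have := domS s chs sS; rewrite /dominates_chain => /set_leP-/(_ _ k).
  rewrite card_reflect_chain // w_card => /(_ erefl).
  by rewrite above_chain // addnC; move: sk; rewrite all_count => /eqP ->.
rewrite /dominates_chain; apply/set_leP; first by rewrite card_reflect_chain.
move=> k; rewrite above_chain // addnC -size_filter; apply: bndS.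
- case/andP: chs => _; apply: sorted_filter; exact: root_gt_trans.
- by apply/allP => b; rewrite mem_filter => /andP[_ /(allP sS)].
- exact: filter_all.
Qed.

End Dominance.

(** * Monomials as functions on the chart *)

Section Monomials.
Variable n : nat.
Local Open Scope ring_scope.

(** Only the columns with index in [v] matter: they span the point with coordinates [x r c]. Keeping
    all matrices square lets [v] vary without changing types. *)
Definition chart (R : pzRingType) (v : {set 'I_n}) (x : 'M[R]_n) : 'M[R]_n :=
  \matrix_(r, c) if r \in v then (r == c)%:R else x r c.

Definition mon (R : comPzRingType) (x : 'M[R]_n) (S : monomial n) : R :=
  \prod_b x b.1 b.2 ^+ S b.

Lemma mon_morph (R R' : comPzRingType) (f : {rmorphism R -> R'}) x S :
  f (mon x S) = mon (map_mx f x) S.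
Proof. by rewrite rmorph_prod; apply: eq_bigr => b _; rewrite rmorphXn mxE. Qed.

Lemma eq_mon (R : comPzRingType) (x y : 'M[R]_n) (S : monomial n) :
  (forall b, S b != 0%N -> x b.1 b.2 = y b.1 b.2) -> mon x S = mon y S.
Proof.
move=> xy; apply: eq_bigr => b _; case: (eqVneq (S b) 0%N) => [->|/xy ->//].
by rewrite !expr0.
Qed.

Lemma mon_scale (R : comPzRingType) a (x : 'M[R]_n) (S : monomial n) :
  mon (a *: x) S = a ^+ mon_degree S * mon x S.
Proof.
rewrite /mon_degree -prodrXr -big_split /=; apply: eq_bigr => b _.
by rewrite mxE exprMn.
Qed.

Variables (K : fieldType).
Hypothesis K_infinite : forall s : seq K, exists a, a \notin s.

(** Extends an identity in a parameter to finitely many excluded values: the polynomial has as many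
    distinct roots as its size. *)
Lemma poly_eq0_cofinite (bad : seq K) (p : {poly K}) :
  (forall a, a \notin bad -> p.[a] = 0) -> p = 0.
Proof.
move=> p0.
have [rs [urs rsp sz]] : exists rs : seq K,
    [/\ uniq rs, all (root p) rs & size rs = size p].
  elim: (size p) => [|m [rs [urs rsp <-]]]; first by exists [::].
  have [a] := K_infinite (bad ++ rs); rewrite mem_cat => /norP[abad ars].
  by exists (a :: rs); rewrite /= urs rsp ars /root p0 // eqxx.
by apply: (roots_geq_poly_eq0 rsp urs); rewrite sz.
Qed.

Section Free.
Variables (T : eqType) (M : T -> monomial n) (c : T -> K).

(** With the other entries frozen, the sum is a polynomial in the entry at [b], so its coefficient
    of degree [e] vanishes. *)
Lemma monomials_split (s : seq T) (b : 'I_n * 'I_n) e :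
  (forall x, \sum_(S <- s) c S * mon x (M S) = 0) ->
  forall x, \sum_(S <- s | M S b == e) c S * mon x (M S) = 0.
Proof.
move=> s0 x.
pose rest S := \prod_(b' | b' != b) x b'.1 b'.2 ^+ M S b'.
pose p := \sum_(S <- s) (c S * rest S)%:P * 'X^(M S b).
have p0 : p = 0.
  apply: (@poly_eq0_cofinite [::]) => a _.
  rewrite -[RHS](s0 (\matrix_(r, k) if (r, k) == b then a else x r k)).
  rewrite horner_sum; apply: eq_bigr => S _.
  rewrite hornerM hornerC hornerXn -mulrA; congr (_ * _).
  rewrite /mon (bigD1 b) //= mxE -surjective_pairing eqxx mulrC; congr (_ * _).
  by apply: eq_bigr => b' b'b; rewrite mxE -surjective_pairing (negPf b'b).
have := congr1 (fun q : {poly K} => q`_e * x b.1 b.2 ^+ e) p0.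
rewrite coef0 mul0r => pe; rewrite -[RHS]pe coef_sum big_distrl /= big_mkcond /=.
apply: eq_bigr => S _; rewrite coefCM coefXn eq_sym.
case: eqP => [->|_] /=; last by rewrite mulr0n mulr0 mul0r.
by rewrite mulr1n mulr1 /mon (bigD1 b) //= -!mulrA [in RHS](mulrC (rest S)).
Qed.

(** Fixing the exponents of all coordinates one after the other isolates the term of [S0]. *)
Lemma monomials_free (s : seq T) : uniq s -> {in s &, injective M} ->
  (forall x, \sum_(S <- s) c S * mon x (M S) = 0) ->
  forall S, S \in s -> c S = 0.
Proof.
move=> us injM s0 S0 S0s.
have split (bs : seq ('I_n * 'I_n)) x :
    \sum_(S <- s | all (fun b => M S b == M S0 b) bs) c S * mon x (M S) = 0.
  elim: bs x => [|b bs IHbs] x; first by rewrite s0.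
  rewrite (eq_bigl (fun S => all (fun b => M S b == M S0 b) bs && (M S b == M S0 b))).
    rewrite -big_filter_cond; apply: monomials_split => y.
    by rewrite big_filter IHbs.
  by move=> S /=; rewrite andbC.
(* Every monomial takes the value 1 at the matrix of ones, so the remaining sum is [c S0]. *)
have := split (enum {: 'I_n * 'I_n}) (const_mx 1).
rewrite big_mkcond (bigD1_seq S0) //= big_seq_cond big1 ?addr0.
  rewrite ifT; last by apply/allP => b _; rewrite /= eqxx.
  by rewrite /mon big1 ?mulr1 // => b _; rewrite mxE expr1n.
move=> S /andP[Ss SS0]; case: ifP => // /allP eqM; case/eqP: SS0.
by apply: injM => //; apply/ffunP => b; apply/eqP/eqM; rewrite mem_enum.
Qed.
End Free.
End Monomials.

(** * Points of the Schubert cell in the chart at v *)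

Section Points.
Variables (n : nat) (K : fieldType).
Local Open Scope ring_scope.
Implicit Types (v w : {set 'I_n}) (x b : 'M[K]_n).

(* The point [x] of the chart at [v] lies in the Borel orbit of [e^w]: [b] is the
   inverse of the usual group element.  The last condition cuts out a dense
   subset of the orbit; it is what makes [orbit_point_shift] possible without
   passing to the closure. *)
Definition orbit_point v w x : Prop := exists b : 'M[K]_n,
  [/\ forall r c : 'I_n, (c < r)%N -> b r c = 0, forall r, b r r != 0,
      forall r c, r \notin w -> c \in v -> (b *m chart v x) r c = 0
    & forall j j' : 'I_n, j' = j.+1 :> nat -> j \in v -> j \notin w ->
        j' \in w -> j' \notin v -> b j j' != 0].

(** Scaling the chart coordinates is the action of the diagonal matrix with entries [m], whose
    inverse is absorbed into the columns of [b]. *)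
Lemma orbit_point_scale v w x (a : K) : a != 0 ->
  orbit_point v w x -> orbit_point v w (a *: x).
Proof.
move=> a0 [b [up dg ker gen]].
pose m r : K := if r \in v then 1 else a.
have m0 r : m r != 0 by rewrite /m; case: ifP => // _; rewrite oner_neq0.
exists (\matrix_(r, c) (b r c / m c)); split.
- by move=> r c /up bz; rewrite mxE bz mul0r.
- by move=> r; rewrite mxE mulf_neq0 // invr_eq0.
- move=> r c rw cv; rewrite -[RHS](ker r c rw cv) !mxE; apply: eq_bigr => j _.
  rewrite !mxE /m; case: (j \in v); first by rewrite divr1.
  by rewrite mulrA divfK.
- by move=> j j' jj' jv jw jw' jv'; rewrite mxE mulf_neq0 ?invr_eq0 // gen.
Qed.

Section Swap.
Variables (i i' : 'I_n).
Hypothesis ii' : i' = i.+1 :> nat.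
Local Notation sg := (tperm i i').
Definition raise v : {set 'I_n} := i' |: (v :\ i).

Lemma i'i : (i' == i) = false.
Proof. by apply/eqP => /(congr1 val) /=; lia. Qed.
Lemma i_i' : (i == i') = false.
Proof. by rewrite eq_sym i'i. Qed.
Lemma tperm_out r : r != i -> r != i' -> sg r = r.
Proof. by move=> ri ri'; rewrite tpermD // eq_sym. Qed.
Lemma lt_after r : r != i' -> (i < r)%N -> (i' < r)%N.
Proof. by rewrite -(inj_eq val_inj) /=; lia. Qed.
Lemma sum_split2 (R : pzRingType) (F : 'I_n -> R) :
  \sum_j F j = F i + F i' + \sum_(j | (j != i) && (j != i')) F j.
Proof. by rewrite (bigD1 i) //= (bigD1 i') ?i'i //= addrA. Qed.

Variables (v w : {set 'I_n}).
Hypotheses (iv : i \in v) (i'v : i' \notin v).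

Lemma in_raise j : (j \in raise v) = (sg j \in v).
Proof.
rewrite !inE; case: tpermP => [->|->|/eqP ji /eqP ji'].
- by rewrite i_i' eqxx (negPf i'v).
- by rewrite eqxx iv.
- by rewrite (negPf ji) (negPf ji').
Qed.

(** The hypothesis on [w] makes the Schubert variety stable under the simple transposition and under
    adding multiples of row [i] to row [i']. The transposed point may leave the open orbit, but its
    translates along [(i', i)] lie in it for all but one [t]. *)
Lemma orbit_point_swap x : ~~ ((i \in w) && (i' \notin w)) ->
  orbit_point (raise v) w x ->
  exists t0, forall t, t != t0 -> orbit_point v w
    (\matrix_(r, c) (x (sg r) (sg c) + (if (r == i') && (c == i) then t else 0))).
Proof.
move=> wi [b [up dg ker gen]]; exists (b i i' / b i i) => t tt0.
have den : b i i' - t * b i i != 0.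
  by apply: contraNneq tt0 => /eqP; rewrite subr_eq0 => /eqP ->; rewrite mulfK.
(* [h] is [b] times the inverse of the transposition followed by the translation. It satisfies the
   kernel condition but is not triangular at [(i', i)]; [bt] clears this entry with the pivot
   [h i i], which is zero only for [t = t0]. *)
pose h r c := if c == i then b r i' - t * b r i else if c == i' then b r i else b r c.
have hii : h i i != 0 by rewrite /h eqxx.
have hi'i : h i' i = b i' i' by rewrite /h eqxx (up i' i) ?mulr0 ?subr0 // ii'.
pose g := - (h i' i / h i i).
pose bt : 'M[K]_n := \matrix_(r, c) (h r c + (if r == i' then g * h i c else 0)).
set xt := \matrix_(r, c) _.
have chE j c : c \in v -> chart v xt j c =
    chart (raise v) x (sg j) (sg c) + (if (j == i') && (c == i) then t else 0).
  move=> cv; rewrite !mxE in_raise tpermK (inj_eq perm_inj); case: ifP => // jv.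
  by case: (eqVneq j i') jv => [->|_]; rewrite ?(negPf i'v) //= addr0.
have hker r c : r \notin w -> c \in v -> \sum_j h r j * chart v xt j c = 0.
  move=> rw cv; rewrite -[RHS](ker r (sg c) rw); last by rewrite in_raise tpermK.
  rewrite mxE [RHS](reindex_inj (@perm_inj _ sg)) !sum_split2 /=.
  rewrite tpermL tpermR !chE // tpermL tpermR /h !eqxx i'i i_i' /=.
  have -> : chart (raise v) x i' (sg c) = (c == i)%:R.
    by rewrite mxE in_raise tpermR iv -{1}(tpermL i i') (inj_eq perm_inj) eq_sym.
  congr (_ + _); first by case: eqP => _ /=; rewrite ?mulr1n ?mulr0n; ring.
  apply: eq_bigr => j /andP[ji ji']; rewrite chE // (negPf ji) (negPf ji') addr0.
  by rewrite tperm_out.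
exists bt; split.
- move=> r c cr; rewrite mxE; case: (eqVneq r i') => [ri|ri].
    subst r; case: (eqVneq c i) => [->|ci]; first by rewrite /g mulNr divfK ?subrr.
    have ci' : (c < i)%N.
      by move: ci cr; rewrite -(inj_eq val_inj) /=; lia.
    have c_i' : c != i' by apply: contraTneq cr => ->; rewrite ltnn.
    by rewrite /h (negPf ci) (negPf c_i') up // up // mulr0 addr0.
  rewrite addr0 /h; case: (eqVneq c i) cr => [->|ci] cr.
    by rewrite (up r i) // up ?mulr0 ?subr0 // lt_after.
  case: (eqVneq c i') cr => [->|ci'] cr; last exact: up.
  by rewrite up //; lia.
- move=> r; rewrite mxE; case: (eqVneq r i') => [->|ri]; last first.
    rewrite addr0; case: (eqVneq r i) => [-> //|ri0].
    by rewrite /h (negPf ri) (negPf ri0).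
  rewrite /h i'i eqxx (up i' i) ?ii' // add0r mulf_neq0 //.
  by rewrite oppr_eq0 mulf_neq0 ?invr_eq0 // hi'i.
- move=> r c rw cv; rewrite mxE.
  have -> : \sum_j bt r j * chart v xt j c = \sum_j h r j * chart v xt j c +
     (if r == i' then g * \sum_j h i j * chart v xt j c else 0).
    case: ifP => ri; last first.
      by rewrite addr0; apply: eq_bigr => j _; rewrite mxE ri addr0.
    rewrite big_distrr -big_split /=; apply: eq_bigr => j _.
    by rewrite mxE ri mulrDl mulrA.
  (* If [i'] is outside [w], so is [i]; hence the added row satisfies the kernel condition too. *)
  rewrite hker // add0r; case: eqP => // ri; rewrite hker ?mulr0 //.
  by rewrite ri in rw; move: wi; rewrite rw andbT.
- move=> j j' jj' jv jw jw' jv'; rewrite mxE.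
  have ji' : (j == i') = false by apply: contraNF i'v => /eqP <-.
  have j'i : (j' == i) = false by apply: contraNF jv' => /eqP ->.
  rewrite ji' addr0 /h j'i; case: (eqVneq j' i') => [j'i'|j'i'].
    have -> : j = i by apply: val_inj => /=; move: jj' ii'; rewrite j'i' => -> [].
    exact: dg.
  have ji : j != i.
    by apply: contraNneq j'i' => ji; apply/eqP/val_inj; rewrite /= jj' ji ii'.
  apply: gen => //; rewrite in_raise tperm_out //; by [rewrite ji'|rewrite j'i].
Qed.

(* Change of chart: up to the torus, [x] is translated along its coordinate
   [(i, i')] until this coordinate becomes a multiple of [z^-1]. *)
Lemma orbit_point_flip x z : i \in w -> z != 0 -> orbit_point (raise v) w x ->
  orbit_point v w (\matrix_(r, c)
    if c == i then if r == i' then z else x r i'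
    else if r == i' then x i c else x r c + x i c * x r i' / z).
Proof.
move=> iw z0 [b [up dg ker gen]]; set xt := \matrix_(r, c) _.
(* The columns [i] and [i'] of [b] are multiplied by the upper triangular block with rows
   [(-z, 1 + x i i' / z)] and [(0, 1 / z)]. *)
pose bt : 'M[K]_n := \matrix_(r, c)
  if c == i then - z * b r i
  else if c == i' then (1 + x i i' / z) * b r i + b r i' / z else b r c.
have i'sv : i' \in raise v by rewrite in_raise tpermR.
have isv : i \notin raise v by rewrite in_raise tpermL.
exists bt; split.
- move=> r c cr; rewrite mxE; case: (eqVneq c i) cr => [->|ci] cr.
    by rewrite up ?mulr0.
  case: (eqVneq c i') cr => [->|ci'] cr; last exact: up.
  by rewrite up 1?up // ?mulr0 ?mul0r ?addr0 //; lia.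
- move=> r; rewrite mxE; case: (eqVneq r i) => [->|ri].
    by rewrite mulf_neq0 // oppr_eq0.
  case: (eqVneq r i') => [->|//].
  by rewrite up ?ii' // mulr0 add0r mulf_neq0 // invr_eq0.
- move=> r c rw cv.
  have kE c' : c' \in raise v -> b r i * chart (raise v) x i c' +
       b r i' * (i' == c')%:R +
       \sum_(j | (j != i) && (j != i')) b r j * chart (raise v) x j c' = 0.
    move=> c'sv; rewrite -[RHS](ker r c' rw c'sv) [RHS]mxE [RHS]sum_split2.
    by congr (_ + _ * _ + _); rewrite mxE i'sv.
  have := kE i' i'sv; rewrite eqxx mxE (negPf isv) => k1.
  rewrite mxE sum_split2.
  have -> : bt r i = - z * b r i by rewrite mxE eqxx.
  have -> : bt r i' = (1 + x i i' / z) * b r i + b r i' / z.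
    by rewrite mxE i'i eqxx.
  have -> : chart v xt i c = (i == c)%:R by rewrite mxE iv.
  have -> : chart v xt i' c = if c == i then z else x i c.
    by rewrite !mxE (negPf i'v) eqxx.
  (* Column [i] of the new chart gives back the condition for column [i'] at [raise v]; any other
     column [c] gives the condition for [c] plus [x i c / z] times the one for [i']. *)
  case: (eqVneq c i) => [ci|ci].
    rewrite ci (eq_bigr (fun j => b r j * chart (raise v) x j i')).
      rewrite -[RHS]k1 /= mulr1n; field; exact: z0.
    move=> j /andP[ji ji']; rewrite !mxE (negPf ji) (negPf ji') in_raise.
    by rewrite tperm_out // eqxx.
  have c_i' : c != i' by apply: contraNneq i'v => <-.
  have csv : c \in raise v by rewrite in_raise tperm_out.
  have := kE c csv; rewrite mxE (negPf isv) eq_sym (negPf c_i') => k2.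
  rewrite (eq_bigr (fun j => b r j * chart (raise v) x j c +
     (x i c / z) * (b r j * chart (raise v) x j i'))).
    rewrite big_split -big_distrr /=.
    move: k1 k2; set s1 := \sum_(_ | _) _; set s2 := \sum_(_ | _) _ => k1 k2.
    have -> : s1 = - (b r i * x i i' + b r i').
      by apply/eqP; rewrite -addr_eq0 -[X in _ == X]k1 /= mulr1n; apply/eqP; ring.
    have -> : s2 = - (b r i * x i c).
      by apply/eqP; rewrite -addr_eq0 -[X in _ == X]k2 /= mulr0n; apply/eqP; ring.
    rewrite /= mulr0n; field; exact: z0.
  move=> j /andP[ji ji']; rewrite !mxE (negPf ji) (negPf ji') in_raise.
  rewrite tperm_out // (negPf ci); case: ifP => _ /=; last by ring.
  by rewrite mulr0n !mulr0 addr0.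
- move=> j j' jj' jv jw jw' jv'; rewrite mxE.
  have j'i : (j' == i) = false by apply: contraNF jv' => /eqP ->.
  have ji : j != i by apply: contraNneq jw => ->.
  have j'i' : j' != i'.
    apply: contraNneq ji => j'i'; apply/eqP/val_inj => /=.
    by move: jj' ii'; rewrite j'i' => -> [].
  have ji' : j != i' by apply: contraNneq i'v => <-.
  by rewrite j'i (negPf j'i') gen // in_raise tperm_out ?j'i.
Qed.

(** Exchanging the rows [i] and [i'] of [b] turns the kernel condition for the raised [w] into the
    one for [w], and the shift by [t] restores the triangular shape. The last condition of
    [orbit_point] ensures that the pivot [b i i'] is nonzero. *)
Lemma orbit_point_shift x : i \in w -> i' \notin w ->
  orbit_point v (i' |: (w :\ i)) x ->
  exists t, orbit_point v w
    (\matrix_(r, c) (x r c + (if (r == i') && (c == i) then t else 0))).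
Proof.
move=> iw i'w [b [up dg ker gen]]; set w2 := i' |: (w :\ i) in ker gen.
have w2E j : (j \in w2) = (sg j \in w).
  rewrite !inE; case: tpermP => [->|->|/eqP ji /eqP ji'].
  - by rewrite i_i' eqxx (negPf i'w).
  - by rewrite eqxx iw.
  - by rewrite (negPf ji) (negPf ji').
have bii' : b i i' != 0 by rewrite gen // w2E ?tpermL ?tpermR.
exists (b i i / b i i'); set t := b i i / b i i'; set xt := \matrix_(r, c) _.
pose h r c := b r c - (if c == i then t * b r i' else 0).
exists (\matrix_(r, c) h (sg r) c); split.
- move=> r c cr; rewrite mxE /h; case: tpermP cr => [->|->|/eqP ri /eqP ri'] cr.
  + have ci : c != i by apply: contraTneq cr => ->; rewrite ltnn.
    by rewrite (negPf ci) subr0 up //; lia.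
  + case: (eqVneq c i) cr => [->|ci] cr; first by rewrite divfK // subrr.
    by rewrite subr0 up //; move: ci cr; rewrite -(inj_eq val_inj) /=; lia.
  + rewrite up // sub0r; case: eqP cr => [->|_] cr; last by rewrite oppr0.
    by rewrite up ?mulr0 ?oppr0 // lt_after.
- move=> r; rewrite mxE /h; case: tpermP => [->|->|/eqP ri /eqP ri'].
  + rewrite eqxx up ?ii' // sub0r oppr_eq0 mulf_neq0 // mulf_neq0 //.
    by rewrite invr_eq0.
  + by rewrite i'i subr0.
  + by rewrite (negPf ri) subr0.
- move=> r c rw cv; rewrite -(tpermK i i' r) -w2E in rw.
  rewrite -[RHS](ker _ c rw cv) !mxE !sum_split2 !mxE /h.
  rewrite iv (negPf i'v) !eqxx i'i /=.
  have -> : \sum_(j | (j != i) && (j != i'))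
     (\matrix_(r, c) (b (sg r) c - (if c == i then t * b (sg r) i' else 0))) r j
      * chart v xt j c =
     \sum_(j | (j != i) && (j != i')) b (sg r) j * chart v x j c.
    apply: eq_bigr => j /andP[ji ji'].
    by rewrite !mxE (negPf ji) (negPf ji') /= subr0 addr0.
  congr (_ + _); rewrite eq_sym; case: eqP => _ /=; rewrite ?mulr1n ?mulr0n; ring.
- move=> j j' jj' jv jw jw' jv'; rewrite mxE /h.
  have j'i : (j' == i) = false by apply: contraNF jv' => /eqP ->.
  have ji : j != i by apply: contraNneq jw => ->.
  have j'i' : j' != i' by apply: contraNneq i'w => <-.
  have ji' : j != i' by apply: contraNneq i'v => <-.
  by rewrite j'i subr0 tperm_out // gen // w2E tperm_out // j'i.
Qed.
End Swap.
End Points.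

(** * Monomials and chains under a simple transposition *)

Lemma ord_neq n (r c : 'I_n) : r != c -> r <> c :> nat.
Proof. by move/eqP => rc /val_inj. Qed.

Section Relabel.
Variables (n : nat) (i i' : 'I_n).
Hypothesis ii' : i' = i.+1 :> nat.
Local Notation sg := (tperm i i').
Local Notation sg2 b := (sg b.1, sg b.2).
Local Notation raise := (raise i i').
Implicit Types (S : monomial n) (A v w : {set 'I_n}).

Lemma sum_raise A (F : 'I_n -> nat) : i \in A -> i' \notin A ->
  \sum_(a in raise A) F a + F i = \sum_(a in A) F a + F i'.
Proof.
move=> iA i'A; rewrite /raise big_setU1 /=; last by rewrite !inE (negPf i'A) andbF.
by rewrite (big_setD1 i iA) /= addnC addnCA [LHS]addnC.
Qed.

Lemma above_raise A k : i \in A -> i' \notin A ->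
  above (raise A) k = above A k + (k == i').
Proof.
move=> iA i'A; have := @sum_raise A (fun a => k <= a : nat) iA i'A.
rewrite /= -/(above _ _) -/(above _ _) => h.
suff : (k <= i') = (k <= i) + (k == i') :> nat by lia.
by rewrite ii'; case: (ltngtP k i.+1); lia.
Qed.

Lemma card_raise A : i \in A -> i' \notin A -> #|raise A| = #|A|.
Proof.
by move=> iA i'A; have := @sum_raise A (fun=> 1) iA i'A; rewrite !sum1_card; lia.
Qed.

Definition relabel S : monomial n := [ffun b => S (sg2 b)].

Lemma relabel_inj : injective relabel.
Proof.
move=> S S' /ffunP eqS; apply/ffunP => -[r c].
by have := eqS (sg r, sg c); rewrite !ffunE /= !tpermK.
Qed.

Lemma mon_relabel (R : comPzRingType) (x : 'M[R]_n) S :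
  mon x (relabel S) = mon (\matrix_(r, c) x (sg r) (sg c)) S.
Proof.
have sgK : involutive (fun b : 'I_n * 'I_n => sg2 b) by case=> r c /=; rewrite !tpermK.
rewrite /mon (reindex_inj (inv_inj sgK)); apply: eq_bigr => -[r c] _.
by rewrite ffunE mxE /= !tpermK.
Qed.

Variables (v w : {set 'I_n}).
Hypotheses (iv : i \in v) (i'v : i' \notin v).

Lemma relabel_support S : mon_support S \subset Rset v ->
  mon_support (relabel S) \subset Rset (raise v).
Proof.
move/subsetP => SR; apply/subsetP => b; rewrite inE ffunE => Sb.
have := SR (sg2 b); rewrite inE => /(_ Sb).
by rewrite inE [in X in _ -> X]inE !in_raise.
Qed.

(** Elements of [relabel S] have row other than [i'] and column other than [i], so exchanging [i]
    and [i'] preserves the strict order of the rows and of the columns. Straddling changes only at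
    [k = i'], where it sharpens: the image straddles [i], [i'] and [i' + 1]. *)
Lemma chain_relabel S k s : mon_support S \subset Rset v ->
  sorted (@root_gt n) s -> all (mem (mon_support (relabel S))) s ->
  all (straddles k) s ->
  let s' : seq ('I_n * 'I_n) := [seq sg2 b | b <- s] in
  [/\ sorted (@root_gt n) s', all (mem (mon_support S)) s'
    & if k == i' then all (fun b : 'I_n * 'I_n => (b.2 < i) && (i' < b.1)) s'
      else all (straddles k) s'].
Proof.
move=> /subsetP SR ss /allP sS /allP sk s'.
have sV b : b \in s -> [/\ b.1 != i' , b.2 != i & S (sg2 b) != 0].
  move=> bs; have := sS _ bs; rewrite /= inE ffunE => Sb.
  have : (sg b.1, sg b.2) \in Rset v by apply: SR; rewrite inE.
  rewrite inE /= => /andP[b1 b2]; split=> //.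
    by apply: contraNneq b1 => ->; rewrite tpermR.
  by apply: contraTneq b2 => ->; rewrite tpermL.
have sgr (r : 'I_n) : r != i' -> sg r = (if (r == i :> nat) then i.+1 else r) :> nat.
  move=> ri'; case: tpermP => [->|ri|/eqP ri _]; first by rewrite eqxx.
    by rewrite ri eqxx in ri'.
  by rewrite -(inj_eq val_inj) in ri; rewrite (negPf ri).
have sgc (r : 'I_n) : r != i -> sg r = (if (r == i' :> nat) then i : nat else r) :> nat.
  move=> ri'; case: tpermP => [ri|->|_ /eqP ri]; last 2 first.
  - by rewrite eqxx.
  - by rewrite -(inj_eq val_inj) in ri; rewrite (negPf ri).
  - by rewrite ri eqxx in ri'.
split.
- rewrite sorted_map; apply: (@sub_in_sorted _ (mem s)) ss; last exact/allP.
  move=> [ar ac] [br bc] /sV[/= a1 a2 _] /sV[/= b1 b2 _].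
  rewrite /root_gt /= => /andP[lt1 lt2].
  rewrite (sgr _ a1) (sgr _ b1) (sgc _ a2) (sgc _ b2).
  move/ord_neq: a1 => a1; move/ord_neq: a2 => a2.
  move/ord_neq: b1 => b1; move/ord_neq: b2 => b2.
  by apply/andP; split; do 2?case: eqP; lia.
- by apply/allP => _ /mapP[b bs ->]; have [_ _] := sV b bs; rewrite /= inE.
have sE (r c : 'I_n) : (r, c) \in s -> [/\ r <> i' :> nat, c <> i :> nat, c < k <= r,
    sg r = (if r == i :> nat then i.+1 else r) :> nat
    & sg c = (if c == i' :> nat then i : nat else c) :> nat].
  move=> bs; have [/= b1 b2 _] := sV _ bs; split; try exact: ord_neq.
  - exact: sk _ bs.
  - exact: sgr.
  - exact: sgc.
case: eqP => [ki'|ki']; apply/allP => _ /mapP[[r c] /sE[r1 c1 /andP[h1 h2] er ec] ->].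
  by rewrite /= er ec; apply/andP; split; case: eqP; lia.
by rewrite /straddles /= er ec; apply/andP; split; case: eqP; lia.
Qed.

(** Raising [v] adds one to [above] at [k = i'] only. There the relabelled chain also straddles [i]
    and [i' + 1]: the bound at [i] suffices if [i] is not in [w], the bound at [i' + 1] if [i'] is
    in [w]. *)
Lemma chain_bounded_swap S : ~~ ((i \in w) && (i' \notin w)) ->
  mon_support S \subset Rset v -> chain_bounded v w S ->
  chain_bounded (raise v) w (relabel S).
Proof.
move=> wi SR bnd k s ss sS sk.
have [ss' sS' sk'] := chain_relabel SR ss sS sk.
rewrite above_raise // addnA.
case: eqP sk' => [->|_] sk'.
  have bnd' k' : i <= k' <= i.+2 -> size s + above v k' <= above w k'.
    move=> hk; have := bnd k' _ ss' sS'; rewrite size_map; apply.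
    by apply: sub_all sk' => b; rewrite /straddles; lia.
  have b0 : size s + above v i <= above w i by apply: bnd'; lia.
  have b2 : size s + above v i.+2 <= above w i.+2 by apply: bnd'; lia.
  have := aboveS v i; have := aboveS v i'; have := aboveS w i; have := aboveS w i'.
  rewrite iv (negPf i'v) -!ii' /= => a1 a2 a3 a4; rewrite -ii' in b2.
  by move: wi; case iw: (i \in w) a2; case i'w: (i' \in w) a1; rewrite //=; lia.
by rewrite addn0; have := bnd _ _ ss' sS' sk'; rewrite size_map.
Qed.

Definition erase S : monomial n := [ffun b => if b == (i', i) then 0 else S b].

Lemma erase_support S : mon_support (erase S) \subset mon_support S.
Proof. by apply/subsetP => b; rewrite !inE ffunE; case: (b == _). Qed.

(** At [k = i'] the missing one comes from [(i', i)] itself, which extends the relabelled chain at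
    its lower end. *)
Lemma chain_bounded_flip S : mon_support S \subset Rset v ->
  S (i', i) != 0 -> chain_bounded v w S ->
  chain_bounded (raise v) w (relabel (erase S)).
Proof.
move=> SR Sy bnd k s ss sS sk.
have [ss' sS' sk'] := chain_relabel (subset_trans (erase_support S) SR) ss sS sk.
have {}sS' : all (mem (mon_support S)) [seq sg2 b | b <- s].
  by apply: sub_all sS' => b; apply: (subsetP (erase_support S)).
rewrite above_raise // addnA; case: eqP sk' => [->|_] sk'; last first.
  by rewrite addn0; have := bnd _ _ ss' sS' sk'; rewrite size_map.
have := bnd i' (rcons [seq sg2 b | b <- s] (i', i)).
rewrite size_rcons size_map addn1 addSn; apply.
- move: sk' ss'; set t := map _ s; case: t => //= a t.
  rewrite rcons_path => /andP[ha /allP ht] ->.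
  have : last a t \in a :: t by rewrite mem_last.
  by rewrite inE => /orP[/eqP ->|/ht]; rewrite /root_gt /= andbC.
- by rewrite all_rcons sS' andbT /= inE.
- rewrite all_rcons /straddles /= ii' !leqnn /=; apply: sub_all sk' => b.
  by rewrite ii' /=; lia.
Qed.

End Relabel.

(** * Linear independence of the dominated monomials *)

Section Independence.
Variables (n : nat) (K : fieldType).
Hypothesis K_infinite : forall s : seq K, exists a, a \notin s.
Implicit Types (v w : {set 'I_n}).
Local Open Scope ring_scope.

(** Indexing the monomials by an arbitrary type lets a relation pass to relabelled or erased
    monomials with its coefficients unchanged. *)
Definition independent v w : Prop :=
  forall (T : eqType) (s : seq T) (M : T -> monomial n) (c : T -> K),
    uniq s -> {in s &, injective M} ->
    (forall S, S \in s ->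
       mon_support (M S) \subset Rset v /\ chain_bounded v w (M S)) ->
    (forall x, orbit_point v w x -> \sum_(S <- s) c S * mon x (M S) = 0) ->
    forall S, S \in s -> c S = 0.

Section Step.
Variables (i i' : 'I_n) (v w : {set 'I_n}).
Hypotheses (ii' : i' = i.+1 :> nat) (iv : i \in v) (i'v : i' \notin v).
Local Notation sg := (tperm i i').

(** Along the line of [orbit_point_swap] the relation is a polynomial in [t] vanishing for
    [t != t0], hence also at [t = 0], where it relates the relabelled monomials. *)
Lemma independent_swap : ~~ ((i \in w) && (i' \notin w)) ->
  independent (raise i i' v) w -> independent v w.
Proof.
move=> wi ind T s M c us injM dom zero.
apply: (ind T s (fun S => relabel i i' (M S))) => //.
- by move=> S S' Ss S's /relabel_inj; apply: injM.
- move=> S /dom[SR bnd]; split; first exact: relabel_support.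
  exact: chain_bounded_swap.
move=> x /(orbit_point_swap ii' iv i'v wi)[t0 Ht].
pose X : 'M[{poly K}]_n := \matrix_(r, k)
  ((x (sg r) (sg k))%:P + (if (r == i') && (k == i) then 'X else 0)).
pose p := \sum_(S <- s) (c S)%:P * mon X (M S).
have pE t : p.[t] = \sum_(S <- s) c S * mon
    (\matrix_(r, k) (x (sg r) (sg k) + (if (r == i') && (k == i) then t else 0))) (M S).
  rewrite horner_sum; apply: eq_bigr => S _; rewrite hornerM hornerC; congr (_ * _).
  rewrite -[LHS]/(horner_eval t _) mon_morph; apply: eq_mon => b _; rewrite !mxE /=.
  by rewrite /horner_eval hornerD hornerC; case: ifP; rewrite ?hornerX ?hornerC.
have p0 : p = 0.
  apply: (poly_eq0_cofinite K_infinite (bad := [:: t0])) => t.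
  by rewrite inE => /Ht; rewrite pE; apply: zero.
have := pE 0; rewrite p0 horner0 => z; rewrite [RHS]z; apply: eq_bigr => S _; rewrite mon_relabel.
by congr (_ * _); apply: eq_mon => b _; rewrite !mxE; case: ifP; rewrite addr0.
Qed.

Lemma independent_flip : i \in w -> i' \notin w ->
  independent (raise i i' v) w -> independent v (i' |: (w :\ i)) ->
  independent v w.
Proof.
move=> iw i'w ind1 ind2 T s M c us injM dom zero.
pose y := (i', i).
(* Descent on a bound for the degree in [y]: the terms of degree [m + 1] give a relation at
   [raise v], so their coefficients vanish. *)
have top m : (forall S, S \in s -> c S != 0 -> (M S y <= m)%N) ->
    forall S, S \in s -> c S != 0 -> M S y = 0%N.
  elim: m => [|m IHm] bm S Ss cS; first by apply/eqP; rewrite -leqn0 bm.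
  apply: (IHm _ S Ss cS) => {Ss cS}S Ss cS; have := bm S Ss cS.
  rewrite leq_eqVlt => /orP[/eqP Sy|//].
  pose s1 := [seq S <- s | (c S != 0) && (M S y == m.+1)].
  suff /eqP : c S = 0 by rewrite (negPf cS).
  have s1P U : U \in s1 -> [/\ U \in s, c U != 0 & M U y = m.+1].
    by rewrite mem_filter => /andP[/andP[-> /eqP ->] ->].
  apply: (ind1 T s1 (fun S => relabel i i' (erase i i' (M S)))).
  - by rewrite filter_uniq.
  - move=> U U' /s1P[Us _ Uy] /s1P[U's _ U'y] /relabel_inj/ffunP eqU.
    apply: injM => //; apply/ffunP => b; have := eqU b; rewrite !ffunE.
    by case: eqP => [->|_]; rewrite ?Uy ?U'y.
  - move=> U /s1P[Us _ Uy]; have [SR bnd] := dom U Us; split.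
      apply: relabel_support => //; exact: subset_trans (erase_support _ _ _) SR.
    by apply: chain_bounded_flip => //; rewrite -/y Uy.
  - move=> x xP.
    (* The flipped point for [z = a^-1], with its entry [z] at [y] replaced by 1: after
       multiplication by [a ^+ m.+1], the powers of this entry become the factors
       ['X^(m.+1 - M S y)] of [p]. At [a = 0] only the terms of top degree in [y] survive. *)
    pose X : 'M[{poly K}]_n := \matrix_(r, k)
      if k == i then if r == i' then 1 else (x r i')%:P
      else if r == i' then (x i k)%:P
           else (x r k)%:P + (x i k * x r i')%:P * 'X.
    pose p := \sum_(S <- s) (c S)%:P * 'X^(m.+1 - M S y) * mon X (M S).
    have XE a : map_mx (horner_eval a) X = \matrix_(r, k)
      if k == i then if r == i' then 1 else x r i'
      else if r == i' then x i k else x r k + x i k * x r i' * a.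
      apply/matrixP => r k; rewrite !mxE /horner_eval.
      by do 2?case: ifP => _; rewrite ?hornerE.
    have pE a : p.[a] = \sum_(S <- s) c S * a ^+ (m.+1 - M S y) *
        mon (map_mx (horner_eval a) X) (M S).
      rewrite horner_sum; apply: eq_bigr => U _.
      by rewrite !hornerM hornerC hornerXn -mon_morph.
    have p0 : p = 0.
      apply: (poly_eq0_cofinite K_infinite (bad := [:: 0])) => a.
      rewrite inE => a0; have ai : a^-1 != 0 by rewrite invr_eq0.
      have := zero _ (orbit_point_flip ii' iv i'v iw ai xP).
      move/(congr1 (fun z => a ^+ m.+1 * z)); rewrite mulr0 => z; rewrite -[RHS]z.
      rewrite pE big_distrr /= !big_seq; apply: eq_bigr => U Us.
      case: (eqVneq (c U) 0) => [->|cU]; first by rewrite !mul0r mulr0.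
      rewrite -!mulrA [RHS]mulrCA; congr (_ * _).
      rewrite -(subnK (bm U Us cU)) exprD addnK -!mulrA; congr (_ * _).
      rewrite /mon (bigD1 y) //= [in RHS](bigD1 y) //= XE !mxE !eqxx expr1n mul1r mulrA exprVn.
      rewrite divff ?expf_neq0 // mul1r; apply: eq_bigr => -[r k] /= rk.
      rewrite !mxE invrK; case: (eqVneq k i) rk => [-> | //].
      by case: (eqVneq r i') => [-> | //]; rewrite eqxx.
    have := pE 0; rewrite p0 horner0 => z; rewrite [RHS]z big_filter big_mkcond /=.
    rewrite !big_seq; apply: eq_bigr => U Us.
    case: (eqVneq (c U) 0) => [->|cU] /=; first by rewrite !mul0r.
    have := bm U Us cU; rewrite leq_eqVlt => /orP[/eqP Uy|Uy]; last first.
      rewrite ifN; last by apply: contraTneq Uy => ->; rewrite ltnn.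
      by rewrite -subn_gt0 in Uy; rewrite expr0n eqn0Ngt Uy mulr0 mul0r.
    rewrite Uy eqxx subnn expr0 mulr1 mon_relabel; congr (_ * _).
    rewrite /mon (bigD1 y) //= [in RHS](bigD1 y) //= ffunE eqxx expr0 XE !mxE !eqxx expr1n.
    congr (_ * _); apply: eq_bigr => b yb; rewrite ffunE (negPf yb).
    case: (eqVneq (M U b) 0%N) => [->|Ub]; first by rewrite !expr0.
    have [/subsetP SR _] := dom U Us; have := SR b; rewrite !inE => /(_ Ub)/andP[b1 b2].
    have b1i : b.1 != i by apply: contraNneq b1 => ->.
    have b2i' : b.2 != i' by apply: contraTneq b2 => ->.
    congr (_ ^+ _); rewrite !mxE mulr0 addr0.
    case: (eqVneq b.2 i) => [b2i|b2i].
      have b1i' : b.1 != i'.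
        by apply: contraNneq yb => b1i'; rewrite (surjective_pairing b) b1i' b2i.
      by rewrite (negPf b1i') b2i tpermL tpermD // eq_sym.
    rewrite [sg b.2]tpermD 1?eq_sym //; case: (eqVneq b.1 i') => [->|b1i'].
      by rewrite tpermR.
    by rewrite tpermD // eq_sym.
  by rewrite mem_filter cS Sy eqxx.
move=> S Ss; apply/eqP; apply: contraT => cS.
have y0 : forall S, S \in s -> c S != 0 -> M S y = 0%N.
  apply: (top (\max_(S <- s) M S y)) => U Us _.
  by apply: leq_bigmax_seq.
suff : c S = 0 by move/eqP; rewrite (negPf cS).
apply: (ind2 T [seq S <- s | c S != 0] M c); last by rewrite mem_filter cS.
- by rewrite filter_uniq.
- by move=> U U'; rewrite !mem_filter => /andP[_ Us] /andP[_ U's]; apply: injM.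
- move=> U; rewrite mem_filter => /andP[_ /dom[SR bnd]]; split=> // k t h1 h2 h3.
  by rewrite (above_raise ii') // (leq_trans (bnd k t h1 h2 h3)) ?leq_addr.
(* All remaining monomials are free of [y], so they take the same value at the shifted point. *)
- move=> x /(orbit_point_shift ii' iv i'v iw i'w)[t /zero z].
  rewrite -[RHS]z big_filter big_mkcond /= !big_seq; apply: eq_bigr => U Us.
  case: (eqVneq (c U) 0) => [->|cU] /=; first by rewrite mul0r.
  congr (_ * _); apply: eq_mon => -[r k] Ub; rewrite mxE /=.
  case: eqP => [ri|_] /=; last by rewrite addr0.
  case: eqP => [ki|_] /=; last by rewrite addr0.
  by rewrite ri ki -/y y0 in Ub.
Qed.
End Step.

(** The second hypothesis makes [v] a final segment. The bound for the empty chain then forces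
    [w = v], and every matrix is an orbit point, so all monomials are independent. *)
Lemma independent_top v w : #|v| = #|w| ->
  (forall i i' : 'I_n, i' = i.+1 :> nat -> i \in v -> i' \in v) ->
  independent v w.
Proof.
move=> vw up T s M c us injM dom zero S Ss.
have upv (a b : 'I_n) : a \in v -> (a <= b)%N -> b \in v.
  move=> av; have [m mb] := ubnP (b - a); elim: m b mb => // m IHm b mb ab.
  case: (eqVneq a b) => [<- //|/eqP neq_ab].
  have lt_ab : (a < b)%N.
    by rewrite ltn_neqAle ab andbT; apply/eqP => /val_inj.
  have hb : (b.-1 < n)%N by apply: leq_ltn_trans (ltn_ord b); rewrite leq_pred.
  apply: (up (Ordinal hb)) => /=; first by rewrite prednK //; lia.
  by apply: IHm => /=; lia.
have wv : w = v.
  apply/esym/eqP; rewrite eqEcard vw leqnn andbT; apply/subsetP => a av.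
  apply/negPn/negP => aw; have [_ bnd] := dom S Ss.
  have := bnd a [::] isT isT isT; rewrite add0n !aboveS av (negPf aw) add1n add0n.
  apply/negP; rewrite -ltnNge ltnS /above.
  rewrite [X in (X <= _)%N]big_mkcond [X in (_ <= X)%N]big_mkcond /=.
  apply: leq_sum => b _; case: (ltnP a b) => // ab; last by do 2?case: ifP.
  by rewrite (upv a) ?(ltnW ab) //; case: ifP.
rewrite wv in zero.
apply: (monomials_free K_infinite us injM) => // x; apply: zero.
(* The identity minus the block of [x] kills the rows outside [v]; it is upper triangular because
   [v] is a final segment. *)
exists (\matrix_(r, k) ((r == k)%:R - (if (r \notin v) && (k \in v) then x r k else 0))).
split.
- move=> r k kr; rewrite mxE.
  have -> : (r == k) = false by apply/eqP => rk; rewrite rk ltnn in kr.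
  rewrite sub0r; case: ifP => [/andP[rv kv]|_]; last by rewrite oppr0.
  by rewrite (upv k) ?(ltnW kr) in rv.
- move=> r; rewrite mxE eqxx ifN ?subr0 ?oner_neq0 //.
  by case: (r \in v).
- move=> r k rv kv; rewrite mxE (bigD1 r) //= (bigD1 k) /=; last first.
    by apply: contraNneq rv => <-.
  rewrite !mxE !eqxx rv kv (negPf rv) /=.
  have -> : (r == k) = false by apply: contraNF rv => /eqP ->.
  rewrite big1; last first.
    move=> j /andP[jr jk]; rewrite !mxE [r == j]eq_sym (negPf jr) rv /=.
    by case: ifP => jv; rewrite ?(negPf jk) ?mulr0 // subr0 mul0r.
  by rewrite subr0 sub0r mul1r mulr1 addr0 addrN.
- by move=> j j' _ jv; rewrite jv.
Qed.

Theorem dominated_independent v w : #|v| = #|w| -> independent v w.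
Proof.
(* Raising [v] or [w] lowers this sum, which serves as induction measure. *)
pose size_of (A : {set 'I_n}) := \sum_(a in A) (n - a)%N.
have [m] := ubnP (size_of v + size_of w)%N.
elim: m v w => // m IHm v w; rewrite ltnS => le_m vw.
have raise_lt (i i' : 'I_n) (A : {set 'I_n}) : i' = i.+1 :> nat -> i \in A -> i' \notin A ->
    (size_of (raise i i' A) < size_of A)%N.
  move=> ii' iA i'A; have := @sum_raise _ i i' A (fun a => n - a)%N iA i'A.
  by rewrite /= -!/(size_of _); have := ltn_ord i'; lia.
have [[i [i' [ii' iv i'v]]]|noasc] := pselect (exists i i' : 'I_n,
    [/\ i' = i.+1 :> nat, i \in v & i' \notin v]); last first.
  apply: independent_top => // i i' ii' iv; apply: contraT => i'v.
  by case: noasc; exists i, i'.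
have lt_v := raise_lt i i' v ii' iv i'v.
have ind1 : independent (raise i i' v) w.
  apply: IHm; last by rewrite card_raise.
  by apply: leq_trans le_m; rewrite ltn_add2r.
case: (boolP ((i \in w) && (i' \notin w))) => [/andP[iw i'w]|]; last first.
  by move=> wi; apply: independent_swap ind1.
apply: independent_flip ind1 _ => //; apply: IHm; last first.
  by rewrite vw; apply: esym; apply: card_raise.
by apply: leq_trans le_m; rewrite ltn_add2l; apply: raise_lt.
Qed.
End Independence.

(** * Pluecker coordinates and evaluation *)

Section Elt.
Variables (d n : nat) (u : Idn d n).

Lemma elt_in j : elt u j \in (u : {set 'I_n}).
Proof. exact: enum_valP. Qed.

Lemma elt_inj : injective (elt u).
Proof. by move=> j j' /enum_val_inj /cast_ord_inj. Qed.

Lemma elt_surj i : i \in (u : {set 'I_n}) -> exists j, elt u j = i.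
Proof.
move=> iu; exists (cast_ord (eqP (valP u)) (enum_rank_in iu i)).
by rewrite /elt cast_ordK enum_rankK_in.
Qed.

Lemma card_Idn : #|(u : {set 'I_n})| = d.
Proof. exact: eqP (valP u). Qed.
End Elt.

(** * Matrices representing points of the Grassmannian *)

Section Matrices.
Local Open Scope ring_scope.

(** By induction on the column [k], the entry [(r, k)] of [invmx b *m b] with [k < r] reduces to
    [invmx b r k * b k k]. *)
Lemma upper_triangular_inv (K : fieldType) n (b : 'M[K]_n) :
  (forall r c : 'I_n, (c < r)%N -> b r c = 0) -> (forall r, b r r != 0) ->
  b \in unitmx /\ upper_triangular_unit (invmx b).
Proof.
move=> up dg.
have ub : b \in unitmx.
  rewrite -unitmx_tr unitmxE det_trig; last first.
    by apply/is_trig_mxP => r c rc; rewrite mxE up.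
  by rewrite unitfE; apply/prodf_neq0 => r _; rewrite mxE.
split=> //; rewrite /upper_triangular_unit unitmx_inv ub /=.
apply/is_trig_mxP => k r kr; rewrite mxE.
have [m km] := ubnP (val k); elim: m k km kr => // m IHm k km kr.
have := mulVmx ub => /matrixP/(_ r k); rewrite !mxE (bigD1 k) //= big1.
  rewrite addr0 (_ : (r == k) = false); last by apply: contraTF kr => /eqP ->; rewrite ltnn.
  by move/eqP; rewrite mulf_eq0 (negPf (dg k)) orbF => /eqP.
move=> j jk; case: (ltngtP j k) => [lt_jk|lt_kj|/val_inj jk']; last by rewrite jk' eqxx in jk.
  by rewrite (IHm j) ?mul0r //; [apply: leq_trans lt_jk _; rewrite -ltnS|apply: ltn_trans lt_jk kr].
by rewrite up ?mulr0.
Qed.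

Variables (d n : nat).

(** The rows are given by an arbitrary map, so that one row can be exchanged without sorting; up to
    sign this is a Pluecker coordinate, or zero if a row is repeated. *)
Definition bracket (R : pzRingType) (A : 'M[R]_(n, d)) (f : 'I_d -> 'I_n) : R :=
  \det (\matrix_(i < d, j < d) A (f i) j).

Definition coord_mx (R : pzRingType) (w : Idn d n) : 'M[R]_(n, d) :=
  \matrix_(r, j) (r == elt w j)%:R.

Definition basis_mx (K : fieldType) (V : {vspace 'cV[K]_n}) : 'M[K]_(n, d) :=
  \matrix_(r, j) (vbasis V)`_j r ord0.

Lemma bracketM (R : comPzRingType) (A : 'M[R]_(n, d)) g f :
  bracket (A *m g) f = bracket A f * \det g.
Proof.
rewrite /bracket -det_mulmx; congr (\det _); apply/matrixP => i j.
by rewrite !mxE; apply: eq_bigr => l _; rewrite !mxE.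
Qed.

Lemma bracket_morph (R R' : comPzRingType) (h : {rmorphism R -> R'}) A f :
  h (bracket A f) = bracket (map_mx h A) f.
Proof.
by rewrite /bracket -det_map_mx; congr (\det _); apply/matrixP => i j; rewrite !mxE.
Qed.

(** The left inverse makes the columns of [A] independent, so the span has dimension exactly [d] and
    the matrix of coordinates in [vbasis V] is invertible. *)
Lemma span_basis_mx (K : fieldType) (V : {vspace 'cV[K]_n}) (A : 'M[K]_(n, d)) L :
  V = <<[seq col j A | j <- enum 'I_d]>>%VS -> L *m A = 1%:M ->
  \dim V = d /\ exists2 g, g \in unitmx & A = basis_mx V *m g.
Proof.
move=> VE LA.
have AV j : col j A \in V by rewrite VE; apply/memv_span/map_f; rewrite mem_enum.
have AE : A = (\matrix_(r, j) (vbasis V)`_j r ord0 : 'M_(n, \dim V)) *m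
    \matrix_(l, j) coord (vbasis V) l (col j A).
  apply/matrixP => r j; rewrite mxE.
  have := coord_vbasis (AV j) => /matrixP/(_ r ord0); rewrite mxE => ->.
  by rewrite summxE; apply: eq_bigr => l _; rewrite !mxE mulrC.
have dV : \dim V = d.
  apply/eqP; rewrite eqn_leq; apply/andP; split.
    by rewrite VE (leq_trans (dim_span _)) // size_map size_enum_ord.
  by move: LA; rewrite AE mulmxA => /mulmx1_min.
have castsum (F : 'I_(\dim V) -> K) :
    \sum_l F l = \sum_(l < d) F (cast_ord (esym dV) l).
  by case: _ / dV; apply: eq_bigr => l _; rewrite cast_ord_id.
split=> //; exists (\matrix_(l, j) coord (vbasis V) (cast_ord (esym dV) l) (col j A)).
  move: LA; rewrite AE mulmxA.
  set C := \matrix_(l, j) coord _ l _; set B := L *m _.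
  move=> BC; have : (\matrix_(j, l) B j (cast_ord (esym dV) l)) *m
      (\matrix_(l, j) coord (vbasis V) (cast_ord (esym dV) l) (col j A)) = 1%:M.
    rewrite -BC; apply/matrixP => j j'; rewrite !mxE.
    rewrite [RHS]castsum.
    by apply: eq_bigr => l _; rewrite !mxE.
  by rewrite {1}AE => /mulmx1_unit[_].
rewrite {1}AE; apply/matrixP => r j; rewrite !mxE.
rewrite castsum.
by apply: eq_bigr => l _; rewrite !mxE.
Qed.

Lemma coord_mx_linv (K : fieldType) (w : Idn d n) :
  (coord_mx K w)^T *m coord_mx K w = 1%:M.
Proof.
apply/matrixP => j j'; rewrite !mxE (bigD1 (elt w j)) //= !mxE eqxx mul1r big1.
  by rewrite addr0 (inj_eq (@elt_inj _ _ w)).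
by move=> r rj; rewrite !mxE (negPf rj) mul0r.
Qed.

Lemma orbit_basis_mx (K : fieldType) (w : Idn d n) (b : 'M[K]_n) :
  b \in unitmx ->
  let V := (linfun (mulmx b) @: coord_space K w)%VS in
  \dim V = d /\ exists2 g, g \in unitmx & b *m coord_mx K w = basis_mx V *m g.
Proof.
move=> ub V; apply: (@span_basis_mx _ _ _ ((coord_mx K w)^T *m invmx b)); last first.
  by rewrite -mulmxA (mulmxA (invmx b)) mulVmx // mul1mx coord_mx_linv.
rewrite /V limg_span; apply: eq_span => y; apply/mapP/mapP => [[z + ->]|[j _ ->]].
  case/mapP=> i; rewrite mem_enum => /elt_surj[j <-] ->; exists j; first by rewrite mem_enum.
  rewrite lfunE /=; apply/matrixP => r c; rewrite !mxE; apply: eq_bigr => l _.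
  by rewrite !mxE ord1 eqxx andbT.
exists (delta_mx (elt w j) ord0); first by apply: map_f; rewrite mem_enum elt_in.
rewrite lfunE /=; apply/matrixP => r c; rewrite !mxE; apply: eq_bigr => l _.
by rewrite !mxE ord1 eqxx andbT.
Qed.

(** The points of the orbit, given by all their bases rather than by the one that [vbasis]
    chooses. *)
Definition orbit_matrix (K : fieldType) (w : Idn d n) (A : 'M[K]_(n, d)) : Prop :=
  exists b g, [/\ upper_triangular_unit b, g \in unitmx &
    A = b *m coord_mx K w *m g].

Lemma orbit_matrixP (K : fieldType) (w : Idn d n) (A : 'M[K]_(n, d)) :
  orbit_matrix w A <-> exists2 V, Borel_orbit w V & \dim V = d /\
    exists2 g, g \in unitmx & A = basis_mx V *m g.
Proof.
split=> [[b [g [tb ug ->]]]|[V [b tb ->] [_ [g ug ->]]]].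
  have ub : b \in unitmx by case/andP: tb.
  exists (linfun (mulmx b) @: coord_space K w)%VS; first by exists b.
  have [dV [h uh ->]] := orbit_basis_mx w ub; split=> //.
  by exists (h *m g); rewrite ?mulmxA // unitmx_mul uh.
have ub : b \in unitmx by case/andP: tb.
have [_ [h uh E]] := orbit_basis_mx w ub.
exists b, (invmx h *m g); split=> //; first by rewrite unitmx_mul unitmx_inv uh.
by rewrite E -!mulmxA (mulmxA h) mulmxV // mul1mx.
Qed.
End Matrices.

(** * Evaluation of polynomials in the Pluecker coordinates *)

Section Evaluation.
Variables (k : fieldType) (d n : nat).
Local Open Scope ring_scope.
Local Notation S := (plucker_poly k d n).

(** Values are taken in a ring, not only in a field, so that a point may depend polynomially on a
    parameter, as in [curve]. *)
Definition ev (R : comNzRingType) (h : {rmorphism k -> R}) (A : 'M[R]_(n, d)) :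
    S -> R := mmap h (fun t => bracket A (elt (enum_val t : Idn d n))).

HB.instance Definition _ (R : comNzRingType) (h : {rmorphism k -> R}) A :=
  GRing.RMorphism.on (@ev R h A).

Section EvMorphism.
Variables (R : comNzRingType) (h : {rmorphism k -> R}) (A : 'M[R]_(n, d)).
Lemma ev0 : ev h A 0 = 0. Proof. exact: rmorph0. Qed.
Lemma ev1 : ev h A 1 = 1. Proof. exact: rmorph1. Qed.
Lemma evD P Q : ev h A (P + Q) = ev h A P + ev h A Q. Proof. exact: rmorphD. Qed.
Lemma evB P Q : ev h A (P - Q) = ev h A P - ev h A Q. Proof. exact: rmorphB. Qed.
Lemma evM P Q : ev h A (P * Q) = ev h A P * ev h A Q. Proof. exact: rmorphM. Qed.
Lemma evX P e : ev h A (P ^+ e) = ev h A P ^+ e. Proof. exact: rmorphXn. Qed.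
Lemma evZ c P : ev h A (c *: P) = h c * ev h A P. Proof. exact: mmapZ. Qed.
End EvMorphism.

Lemma ev_mulmx (R : comNzRingType) (h : {rmorphism k -> R}) A g P e :
  P \is e.-homog -> ev h (A *m g) P = ev h A P * \det g ^+ e.
Proof.
move/dhomogP => homP; rewrite /ev /mmap big_distrl /= !big_seq.
apply: eq_bigr => m /homP <-; rewrite -mulrA; congr (_ * _).
rewrite /mmap1 /= mdegE -prodrXr -big_split /=; apply: eq_bigr => t _.
by rewrite bracketM exprMn.
Qed.

Lemma ev_morph (R R' : comNzRingType) (h : {rmorphism k -> R})
    (f : {rmorphism R -> R'}) A P : f (ev h A P) = ev (f \o h) (map_mx f A) P.
Proof.
rewrite /ev /mmap rmorph_sum; apply: eq_bigr => m _; rewrite rmorphM rmorph_prod.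
by congr (_ * _); apply: eq_bigr => t _; rewrite rmorphXn bracket_morph.
Qed.

Lemma plucker_eval_ev (K : fieldType) (h : {rmorphism k -> K}) V P :
  plucker_eval h V P = ev h (basis_mx d V) P.
Proof.
rewrite /plucker_eval /ev /mmap; apply: eq_bigr => m _; congr (_ * _).
apply: eq_bigr => t _; congr (_ ^+ _); rewrite /plucker /bracket.
by congr (\det _); apply/matrixP => i j; rewrite !mxE.
Qed.

(** By the definition of [Schubert], vanishing on the closure is vanishing on the orbit; a change of
    basis only multiplies the value by a power of a nonzero determinant. *)
Lemma vanishes_evP (w : Idn d n) P e : P \is e.-homog ->
  vanishes_on_Schubert w P <-> forall (L : fieldType) (h : {rmorphism k -> L}) A,
    orbit_matrix w A -> ev h A P = 0.
Proof.
move=> homP; split=> [vanP L h A /orbit_matrixP[V bV [dV [g ug ->]]]|vanP K h U].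
  rewrite (ev_mulmx _ _ _ homP) -plucker_eval_ev vanP ?mul0r //.
  by split=> // f Q _; apply.
case=> _; apply; first exact: homP.
move=> L jota V [b tb VE]; have ub : b \in unitmx by case/andP: tb.
have [_ [g ug E]] := orbit_basis_mx w ub; rewrite -VE in E.
have : ev jota (b *m coord_mx L w) P = 0.
  by apply: vanP; exists b, 1%:M; rewrite mulmx1 unitmx1.
rewrite E (ev_mulmx _ _ _ homP) -plucker_eval_ev => /eqP; rewrite mulf_eq0.
by rewrite expf_eq0 -[\det g == 0]negbK -unitfE -unitmxE ug andbF orbF => /eqP.
Qed.

Lemma value_at_ev_neq0 (v : Idn d n) P e : P \is e.-homog ->
  (value_at_ev v P != 0) = (ev idfun (coord_mx k v) P != 0).
Proof.
move=> homP; have [_ [g ug E]] := orbit_basis_mx v (unitmx1 k n).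
rewrite mul1mx in E; rewrite E (ev_mulmx _ _ _ homP).
have -> : (linfun (mulmx 1%:M) @: coord_space k v)%VS = coord_space k v.
  by rewrite -[RHS]lim1g; congr (_ @: _)%VS; apply/lfunP => x; rewrite !lfunE /= mul1mx.
rewrite /value_at_ev plucker_eval_ev mulf_eq0 expf_eq0.
have /negbTE -> : \det g != 0 by rewrite -unitfE -unitmxE.
by rewrite andbF orbF.
Qed.
End Evaluation.

(** * Relations between maximal minors *)

Section Brackets.
Variables (d n : nat).
Local Open Scope ring_scope.

Definition update (f : 'I_d -> 'I_n) i r : 'I_d -> 'I_n :=
  fun j => if j == i then r else f j.

Lemma bracket_noninj (R : comPzRingType) (A : 'M[R]_(n, d)) f :
  ~ injective f -> bracket A f = 0.
Proof.
move/injectiveP/injectivePn => [i [j ij fij]].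
by apply: (determinant_alternate ij) => l; rewrite !mxE fij.
Qed.

Lemma bracket_ext (R : pzRingType) (A : 'M[R]_(n, d)) f g :
  f =1 g -> bracket A f = bracket A g.
Proof. by move=> fg; congr (\det _); apply/matrixP => i j; rewrite !mxE fg. Qed.

Lemma bracket_update (R : comPzRingType) (A : 'M[R]_(n, d)) m
    (X : 'rV[R]_m) (e : 'I_m -> 'I_n) f i :
  (forall l, A (f i) l = \sum_j X ord0 j * A (e j) l) ->
  bracket A f = \sum_j X ord0 j * bracket A (update f i (e j)).
Proof.
move=> AX; rewrite /bracket (expand_det_row _ i).
have cofE j l : cofactor (\matrix_(i0, j0) A (update f i (e j) i0) j0) i l =
    cofactor (\matrix_(i0, j0) A (f i0) j0) i l.
  rewrite /cofactor; congr (_ * \det _); apply/matrixP => i1 j1; rewrite !mxE.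
  by rewrite /update eq_sym (negPf (neq_lift _ _)).
under [RHS]eq_bigr => j _.
  rewrite (expand_det_row _ i) big_distrr /=.
  under eq_bigr => l _ do rewrite cofE mxE /update eqxx mulrA.
  over.
rewrite exchange_big /=; apply: eq_bigr => l _.
by rewrite mxE AX big_distrl.
Qed.

Section Poly.
Variable k : fieldType.
Local Notation S := (plucker_poly k d n).

(** For injective [f], sorting the rows exhibits the minor as a variable up to sign; otherwise two
    rows agree and the minor is zero. *)
Lemma bracket_poly (f : 'I_d -> 'I_n) : exists P : S, P \is 1.-homog /\
  forall (R : comNzRingType) (h : {rmorphism k -> R}) A, ev h A P = bracket A f.
Proof.
case: (pselect (injective f)) => [injf|ninj]; last first.
  by exists 0; split=> [|R h A]; rewrite ?dhomog0 // raddf0 bracket_noninj.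
have card_u : #|[set f i | i in 'I_d]| == d by rewrite card_imset ?card_ord.
pose u : Idn d n := exist (fun u : {set 'I_n} => #|u| == d) _ card_u.
have /boolp.choice[p fp] i : exists j, elt u j = f i.
  by apply: elt_surj; apply: imset_f.
have injp : injective p by move=> i j pij; apply: injf; rewrite -!fp pij.
exists ((-1) ^+ perm injp *: 'X_(enum_rank u)); split=> [|R h A].
  by apply: rpredZ; rewrite dhomogX /= mdeg1.
rewrite /ev mmapZ mmapX mmap1U enum_rankK rmorphXn rmorphN1.
rewrite /bracket -det_perm -det_mulmx -row_permE; congr (\det _).
by apply/matrixP => i j; rewrite !mxE permE fp.
Qed.

Definition bracket_pol f : S := sval (cid (bracket_poly f)).

Lemma bracket_pol_homog f : bracket_pol f \is 1.-homog.
Proof. by rewrite /bracket_pol; case: cid => P []. Qed.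

Lemma ev_bracket_pol f (R : comNzRingType) (h : {rmorphism k -> R}) A :
  ev h A (bracket_pol f) = bracket A f.
Proof. by rewrite /bracket_pol; case: cid => P []. Qed.
End Poly.

Definition replace (v : Idn d n) (r c : 'I_n) : 'I_d -> 'I_n :=
  fun j => if elt v j == c then r else elt v j.

Lemma replace_elt v r j : replace v r (elt v j) =1 update (elt v) j r.
Proof. by move=> i; rewrite /replace /update (inj_eq (@elt_inj _ _ v)). Qed.

Section Coordinates.
Variables (K : fieldType) (v : Idn d n).
Implicit Types A : 'M[K]_(n, d).

Fact coords_key : unit. Proof. exact: tt. Qed.
(* Locked, lest [mxE] unfold it. *)
Definition coords A : 'M[K]_(n, d) := locked_with coords_key
  (A *m invmx (\matrix_(i < d, j < d) A (elt v i) j)).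

Lemma coordsE A :
  coords A = A *m invmx (\matrix_(i < d, j < d) A (elt v i) j).
Proof. by rewrite /coords unlock. Qed.

Lemma coords_row A r l : bracket A (elt v) != 0 ->
  A r l = \sum_j coords A r j * A (elt v j) l.
Proof.
move=> A0; have : A = coords A *m (\matrix_(i < d, j < d) A (elt v i) j).
  by rewrite coordsE -mulmxA mulVmx ?mulmx1 // unitmxE unitfE.
move/matrixP/(_ r l); rewrite mxE => {1}->.
by apply: eq_bigr => j _; rewrite mxE.
Qed.

(** Cramer's rule: when the new row is expanded in the rows of [v], all terms but the [j]-th repeat
    a row. *)
Lemma bracket_replace A r j : bracket A (elt v) != 0 ->
  bracket A (replace v r (elt v j)) = coords A r j * bracket A (elt v).
Proof.
move=> A0; rewrite (bracket_ext _ (replace_elt v r j)).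
rewrite (@bracket_update _ _ d (row r (coords A)) (elt v) _ j); last first.
  move=> l; rewrite /update eqxx (coords_row _ _ A0).
  by apply: eq_bigr => i _; rewrite mxE.
rewrite (bigD1 j) //= big1 ?addr0 ?mxE.
  congr (_ * _); apply: bracket_ext => i; rewrite /update.
  by case: eqP => // ->.
move=> i ij; rewrite bracket_noninj ?mulr0 // => injf.
have := injf i j; rewrite /update /= (negPf ij) (eq_refl j) => /(_ erefl) eij.
by rewrite eij eqxx in ij.
Qed.

Lemma bracket_exchange A f i : bracket A (elt v) != 0 ->
  bracket A f = \sum_j coords A (f i) j * bracket A (update f i (elt v j)).
Proof.
move=> A0; rewrite (@bracket_update _ _ d (row (f i) (coords A)) (elt v) _ i).
  by apply: eq_bigr => j _; rewrite mxE.
by move=> l; rewrite (coords_row _ _ A0); apply: eq_bigr => j _; rewrite mxE.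
Qed.

Lemma coords_elt A i j : bracket A (elt v) != 0 ->
  coords A (elt v i) j = (i == j)%:R.
Proof.
move=> A0; have u : (\matrix_(i < d, j < d) A (elt v i) j) \in unitmx.
  by rewrite unitmxE unitfE.
rewrite coordsE; have := mulmxV u => /matrixP/(_ i j); rewrite !mxE => <-.
by apply: eq_bigr => l _; rewrite !mxE.
Qed.
End Coordinates.

Lemma sum_elt (u : Idn d n) (F : 'I_n -> nat) :
  (\sum_(a in (u : {set 'I_n})) F a = \sum_j F (elt u j))%N.
Proof.
have -> : (u : {set 'I_n}) = elt u @: [set: 'I_d].
  apply/setP => a; apply/idP/imsetP => [/elt_surj[j <-]|[j _ ->]]; last exact: elt_in.
  by exists j.
rewrite big_imset /=; last by move=> i j _ _; apply: elt_inj.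
by apply: eq_bigl => j; rewrite inE.
Qed.

Lemma above_elt (u : Idn d n) k : above u k = #|[set j | (k <= elt u j)%N]|.
Proof.
rewrite /above sum_elt -sum1_card [RHS]big_mkcond /=.
by apply: eq_bigr => j _; rewrite inE; case: leq.
Qed.

(* Since [b] is upper triangular, the rows of [A] of index at least [k] span a
   space of dimension at most [above w k], while a nonzero minor would yield
   [t + above v k] independent ones. *)
Lemma minor_eq0 (K : fieldType) (v w : Idn d n) (A : 'M[K]_(n, d)) k t
    (r : 'I_t -> 'I_n) (c : 'I_t -> 'I_d) :
  orbit_matrix w A -> bracket A (elt v) != 0 ->
  (forall i, k <= r i)%N -> (forall i, elt v (c i) < k)%N ->
  (above w k < t + above v k)%N ->
  \det (\matrix_(i, j) coords v A (r i) (c j)) = 0.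
Proof.
move=> [b [g [/andP[_ /is_trig_mxP tb] _ AE]]] A0 kr ck; apply: contraTeq => det0.
rewrite -leqNgt addnC.
set J := [set j | (k <= elt v j)%N]; set W := [set j | (k <= elt w j)%N].
have JP (i : 'I_#|J|) : (k <= elt v (enum_val i))%N.
  by have := enum_valP i; rewrite inE.
pose fr (i : 'I_(#|J| + t)) :=
  match split i with inl i => elt v (enum_val i) | inr i => r i end.
pose fc (i : 'I_(#|J| + t)) :=
  match split i with inl i => enum_val i | inr i => c i end.
have kfr i : (k <= fr i)%N by rewrite /fr; case: split.
have frl i : fr (lshift t i) = elt v (enum_val i) by rewrite /fr (unsplitK (inl i)).
have frr i : fr (rshift _ i) = r i by rewrite /fr (unsplitK (inr i)).
have fcl i : fc (lshift t i) = enum_val i by rewrite /fc (unsplitK (inl i)).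
have fcr i : fc (rshift _ i) = c i by rewrite /fc (unsplitK (inr i)).
(* Block lower triangular: the rows taken from [v] give an identity block, the rows [r i] the given
   minor, so [M] is invertible. *)
pose M : 'M[K]_(#|J| + t) := \matrix_(i, j) coords v A (fr i) (fc j).
have uM : M \in unitmx.
  rewrite unitmxE unitfE -(submxK M).
  have -> : ulsubmx M = 1%:M.
    by apply/matrixP => i j; rewrite !mxE frl fcl coords_elt // (inj_eq enum_val_inj).
  have -> : ursubmx M = 0.
    apply/matrixP => i j; rewrite !mxE frl fcr coords_elt //.
    by case: eqP => // eij; have := JP i; rewrite eij leqNgt ck.
  rewrite det_lblock det1 mul1r; congr (_ != 0): det0; congr (\det _).
  by apply/matrixP => i j; rewrite !mxE frr fcr.
pose g' := g *m invmx (\matrix_(i < d, j < d) A (elt v i) j).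
have ME : M = (\matrix_(i < #|J| + t, j < #|W|) b (fr i) (elt w (enum_val j))) *m
    (\matrix_(i < #|W|, j < #|J| + t) g' (enum_val i) (fc j)).
  apply/matrixP => i j; rewrite !mxE.
  have -> : coords v A (fr i) (fc j) = \sum_l b (fr i) (elt w l) * g' l (fc j).
    rewrite coordsE {1}AE -mulmxA -/g' mxE; apply: eq_bigr => l _; congr (_ * _).
    rewrite mxE (bigD1 (elt w l)) //= mxE eqxx mulr1 big1 ?addr0 // => m ml.
    by rewrite mxE (negPf ml) mulr0.
  rewrite (bigID (mem W)) /= [X in _ + X]big1 ?addr0.
    by rewrite big_enum_val; apply: eq_bigr => l _; rewrite !mxE.
  move=> l; rewrite inE -ltnNge => lk.
  have := tb (elt w l) (fr i) (leq_trans lk (kfr i)).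
  by rewrite mxE => ->; rewrite mul0r.
have : (\matrix_(i < #|J| + t, j < #|W|) b (fr i) (elt w (enum_val j))) *m
  ((\matrix_(i < #|W|, j < #|J| + t) g' (enum_val i) (fc j)) *m invmx M) = 1%:M.
  by rewrite mulmxA -ME mulmxV.
by move/mulmx1_min; rewrite !above_elt.
Qed.

Definition chart_mx (R : pzRingType) (v : Idn d n) (x : 'M[R]_n) : 'M[R]_(n, d) :=
  \matrix_(r, j) chart v x r (elt v j).

Lemma bracket_chart (R : comPzRingType) v (x : 'M[R]_n) :
  bracket (chart_mx v x) (elt v) = 1.
Proof.
rewrite /bracket -[RHS](det1 R d); congr (\det _); apply/matrixP => i j.
by rewrite !mxE elt_in (inj_eq (@elt_inj _ _ v)).
Qed.

Lemma coords_chart (K : fieldType) (v : Idn d n) (x : 'M[K]_n) r j : r \notin (v : {set 'I_n}) ->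
  coords v (chart_mx v x) r j = x r (elt v j).
Proof.
move=> rv; rewrite coordsE.
have -> : \matrix_(i < d, j < d) chart_mx v x (elt v i) j = 1%:M.
  by apply/matrixP => i l; rewrite !mxE elt_in (inj_eq (@elt_inj _ _ v)).
by rewrite invmx1 mulmx1 !mxE (negPf rv).
Qed.

(** The kernel condition says that [b] carries the columns of the chart matrix into the span of the
    basis vectors of [w], so [invmx b] is the group element sought. *)
Lemma orbit_point_matrix (K : fieldType) (v w : Idn d n) (x : 'M[K]_n) :
  orbit_point v w x -> orbit_matrix w (chart_mx v x).
Proof.
move=> [b [up dg ker _]]; have [ub tb] := upper_triangular_inv up dg.
pose Q : 'M[K]_d := \matrix_(i, j) (b *m chart_mx v x) (elt w i) j.
have bE : b *m chart_mx v x = coord_mx K w *m Q.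
  apply/matrixP => r j; rewrite [RHS]mxE.
  case: (boolP (r \in (w : {set 'I_n}))) => [/elt_surj[i <-]|rw].
    have w1 : coord_mx K w (elt w i) i = 1 by rewrite mxE eqxx.
    rewrite (bigD1 i) //= w1 mul1r [Q i j]mxE [X in _ + X]big1 ?addr0 // => l li.
    by rewrite !mxE (inj_eq (@elt_inj _ _ w)) eq_sym (negPf li) mul0r.
  rewrite big1.
    have := ker r (elt v j) rw (elt_in v j); rewrite !mxE => kr; rewrite -[RHS]kr.
    by apply: eq_bigr => l _; rewrite mxE.
  move=> l _; rewrite mxE (_ : (r == _) = false) ?mul0r //.
  by apply: contraNF rw => /eqP ->; apply: elt_in.
have AE : chart_mx v x = invmx b *m coord_mx K w *m Q.
  by rewrite -mulmxA -bE mulmxA mulVmx // mul1mx.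
exists (invmx b), Q; split=> //.
have : (coord_mx K v)^T *m chart_mx v x = 1%:M.
  apply/matrixP => i j; rewrite !mxE (bigD1 (elt v i)) //= !mxE eqxx mul1r elt_in.
  rewrite (inj_eq (@elt_inj _ _ v)) big1 ?addr0 // => l li.
  by rewrite !mxE (negPf li) mul0r.
by rewrite AE mulmxA => /mulmx1_unit[].
Qed.
End Brackets.

(** * Germs and the functions they induce *)

Section Germs.
Variables (k : fieldType) (d n : nat) (v w : Idn d n).
Local Open Scope ring_scope.
Local Open Scope quotient_scope.
Local Notation S := (plucker_poly k d n).
Local Notation O := (local_ring k v w).
Local Notation fraction := (fraction k v).
Local Notation num f := (val f).1.
Local Notation den f := (val f).2.

Definition germ (f : fraction) : O := \pi_O f.

Lemma germD f g : germ f + germ g = germ (fraction_add f g).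
Proof. exact: germ_addE. Qed.
Lemma germM f g : germ f * germ g = germ (fraction_mul f g).
Proof. exact: germ_mulE. Qed.
Lemma germZ a f : a *: germ f = germ (fraction_scale a f).
Proof. exact: germ_scaleE. Qed.
Lemma germ_one : 1 = germ (fraction_one k v). Proof. by []. Qed.
Lemma germ_zero : 0 = germ (fraction_zero k v). Proof. by []. Qed.
Lemma germP (a : O) : exists f, a = germ f.
Proof. by exists (generic_quotient.repr a); rewrite /germ reprK. Qed.

Lemma scalarAl (c : k) (a b : O) : c *: (a * b) = (c *: a) * b.
Proof.
have [f ->] := germP a; have [g ->] := germP b.
rewrite germM !germZ germM; congr germ; apply: val_inj => /=.
by rewrite scalerAl.
Qed.

Lemma scalarAr (c : k) (a b : O) : c *: (a * b) = a * (c *: b).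
Proof. by rewrite mulrC scalarAl mulrC. Qed.

Lemma fractionP (f : fraction) : exists e,
  [/\ num f \is e.-homog, den f \is e.-homog & ev idfun (coord_mx k v) (den f) != 0].
Proof.
case: f => -[P Q] /= /andP[/asboolP[e [/= hP hQ]]].
by rewrite (value_at_ev_neq0 _ hQ); exists e.
Qed.

Lemma is_fraction_homog (P Q : S) e : P \is e.-homog -> Q \is e.-homog ->
  ev idfun (coord_mx k v) Q != 0 -> is_fraction v (P, Q).
Proof.
move=> hP hQ Q0; apply/andP; split; last by rewrite (value_at_ev_neq0 _ hQ).
by apply/asboolP; exists e.
Qed.

Local Notation pv := (bracket_pol k (elt v)).

Lemma bracket_coord_mx (R : comPzRingType) : bracket (coord_mx R v) (elt v) = 1.
Proof.
rewrite /bracket -[RHS](det1 R d); congr (\det _); apply/matrixP => i j.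
by rewrite !mxE (inj_eq (@elt_inj _ _ v)).
Qed.

(** The Pluecker coordinate [pv] is nonzero at [e^v]; multiplying by it reduces the equality of
    germs to points where [pv] is nonzero, that is, to the chart. *)
Lemma germ_eq_ev f g :
  (forall (L : fieldType) (h : {rmorphism k -> L}) A, orbit_matrix w A ->
     bracket A (elt v) != 0 ->
     ev h A (num f) * ev h A (den g) = ev h A (num g) * ev h A (den f)) ->
  germ f = germ g.
Proof.
move=> H; apply/eqmodP/asboolP; exists pv.
  split; first by exists 1%N; apply: bracket_pol_homog.
  rewrite (value_at_ev_neq0 _ (bracket_pol_homog _ _)) ev_bracket_pol.
  by rewrite bracket_coord_mx oner_neq0.
have [e [nf df _]] := fractionP f; have [e' [ng dg _]] := fractionP g.
have hom : pv * (num f * den g - num g * den f) \is (1 + (e + e')).-homog.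
  apply: dhomogM; first exact: bracket_pol_homog.
  by apply: rpredB; [|rewrite addnC]; apply: dhomogM.
apply/(vanishes_evP _ hom) => L h A oA; rewrite evM ev_bracket_pol.
case: (eqVneq (bracket A (elt v)) 0) => [->|A0]; first by rewrite mul0r.
by rewrite evB !evM H // subrr mulr0.
Qed.

Lemma ev_germ_eq f g : germ f = germ g -> exists s : S,
  ev idfun (coord_mx k v) s != 0 /\
  forall (L : fieldType) (h : {rmorphism k -> L}) A, orbit_matrix w A ->
    ev h A (s * (num f * den g - num g * den f)) = 0.
Proof.
move=> /eqmodP/asboolP[s [[es hs] s0]] van; exists s.
rewrite -(value_at_ev_neq0 _ hs); split=> //.
have [e [nf df _]] := fractionP f; have [e' [ng dg _]] := fractionP g.
have hom : s * (num f * den g - num g * den f) \is (es + (e + e')).-homog.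
  apply: dhomogM => //.
  by apply: rpredB; [|rewrite addnC]; apply: dhomogM.
exact/(vanishes_evP _ hom).
Qed.

Definition point_fun := forall L : fieldType, {rmorphism k -> L} -> 'M[L]_(n, d) -> L.

Lemma is_fraction_pv (H : S) e : H \is e.-homog -> is_fraction v (H, pv ^+ e).
Proof.
move=> hH; apply: (is_fraction_homog hH).
  by rewrite -[e in e.-homog]mul1n; apply/dhomogMn/bracket_pol_homog.
by rewrite evX ev_bracket_pol bracket_coord_mx expr1n oner_neq0.
Qed.

Definition chart_fraction (H : S) e (hH : H \is e.-homog) : fraction :=
  exist (is_fraction v) _ (is_fraction_pv hH).

(* On the chart, where [pv] does not vanish, the germ [a] is the function [F];
   by [represents_eq], [F] determines [a]. *)
Definition represents (a : O) (F : point_fun) : Prop :=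
  exists (H : S) (e : nat) (hH : H \is e.-homog), a = germ (chart_fraction hH) /\
    forall (L : fieldType) (h : {rmorphism k -> L}) A, bracket A (elt v) != 0 ->
      ev h A H = bracket A (elt v) ^+ e * F L h A.

Lemma represents_eq a b F G : represents a F -> represents b G ->
  (forall (L : fieldType) (h : {rmorphism k -> L}) A, orbit_matrix w A ->
     bracket A (elt v) != 0 -> F L h A = G L h A) ->
  a = b.
Proof.
move=> [H [e [hH [-> EH]]]] [H' [e' [hH' [-> EH']]]] FG.
apply: germ_eq_ev => L h A oA A0 /=.
by rewrite EH // EH' // !evX ev_bracket_pol (FG L h A) //; ring.
Qed.

Lemma represents_homog (H : S) e (hH : H \is e.-homog) :
  represents (germ (chart_fraction hH))
    (fun L h A => ev h A H / bracket A (elt v) ^+ e).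
Proof.
exists H, e, hH; split=> // L h A A0.
by rewrite mulrC divfK // expf_neq0.
Qed.

Lemma represents1 : represents 1 (fun L h A => 1).
Proof.
have h1 : (1 : S) \is 0.-homog by apply: dhomog1.
exists 1, 0%N, h1; split; last by move=> L h A _; rewrite ev1 expr0 mulr1.
by rewrite germ_one; congr germ; apply: val_inj; rewrite /= expr0.
Qed.

Lemma represents0 : represents 0 (fun L h A => 0).
Proof.
have h0 : (0 : S) \is 0.-homog by apply: dhomog0.
exists 0, 0%N, h0; split; last by move=> L h A _; rewrite ev0 mulr0.
by rewrite germ_zero; congr germ; apply: val_inj; rewrite /= expr0.
Qed.

Lemma representsD a b F G : represents a F -> represents b G ->
  represents (a + b) (fun L h A => F L h A + G L h A).
Proof.
move=> [H [e [hH [-> EH]]]] [H' [e' [hH' [-> EH']]]].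
have homp m : pv ^+ m \is m.-homog.
  by rewrite -[m in m.-homog]mul1n; apply/dhomogMn/bracket_pol_homog.
have hom : H * pv ^+ e' + H' * pv ^+ e \is (e + e').-homog.
  by apply: rpredD; [|rewrite addnC]; apply: dhomogM.
exists _, _, hom; split; last first.
  move=> L h A A0; rewrite evD !evM !evX !ev_bracket_pol EH // EH' //.
  by rewrite exprD; ring.
by rewrite germD; congr germ; apply: val_inj; rewrite /= exprD.
Qed.

Lemma representsM a b F G : represents a F -> represents b G ->
  represents (a * b) (fun L h A => F L h A * G L h A).
Proof.
move=> [H [e [hH [-> EH]]]] [H' [e' [hH' [-> EH']]]].
have hom : H * H' \is (e + e').-homog by apply: dhomogM.
exists _, _, hom; split; last first.
  by move=> L h A A0; rewrite evM EH // EH' // exprD; ring.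
by rewrite germM; congr germ; apply: val_inj; rewrite /= exprD.
Qed.

Lemma representsZ c a F : represents a F ->
  represents (c *: a) (fun L h A => h c * F L h A).
Proof.
move=> [H [e [hH [-> EH]]]].
have hom : c *: H \is e.-homog by apply: rpredZ.
exists _, _, hom; split; last first.
  by move=> L h A A0; rewrite evZ EH //; ring.
by rewrite germZ; congr germ; apply: val_inj.
Qed.

Lemma representsN a F : represents a F -> represents (- a) (fun L h A => - F L h A).
Proof.
move=> aF; have := representsZ (-1) aF; rewrite scaleN1r => -[H [e [hH [aE EH]]]].
by exists H, e, hH; split=> // L h A A0; rewrite EH // rmorphN1 mulN1r.
Qed.

Lemma represents_sum (I : Type) (r : seq I) (P : pred I) a (F : I -> point_fun) :
  (forall i, P i -> represents (a i) (F i)) ->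
  represents (\sum_(i <- r | P i) a i) (fun L h A => \sum_(i <- r | P i) F i L h A).
Proof.
move=> aF; elim: r => [|i r IHr].
  have [H [e [hH [E EH]]]] := represents0; exists H, e, hH.
  by rewrite big_nil; split=> // L h A A0; rewrite big_nil EH.
case Pi: (P i).
  have [H [e [hH [E EH]]]] := representsD (aF i Pi) IHr; exists H, e, hH.
  by rewrite big_cons Pi; split=> // L h A A0; rewrite big_cons Pi EH.
have [H [e [hH [E EH]]]] := IHr; exists H, e, hH.
by rewrite big_cons Pi; split=> // L h A A0; rewrite big_cons Pi EH.
Qed.

Lemma represents_prod (I : Type) (r : seq I) (P : pred I) a (F : I -> point_fun) :
  (forall i, P i -> represents (a i) (F i)) ->
  represents (\prod_(i <- r | P i) a i) (fun L h A => \prod_(i <- r | P i) F i L h A).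
Proof.
move=> aF; elim: r => [|i r IHr].
  have [H [e [hH [E EH]]]] := represents1; exists H, e, hH.
  by rewrite big_nil; split=> // L h A A0; rewrite big_nil EH.
case Pi: (P i).
  have [H [e [hH [E EH]]]] := representsM (aF i Pi) IHr; exists H, e, hH.
  by rewrite big_cons Pi; split=> // L h A A0; rewrite big_cons Pi EH.
have [H [e [hH [E EH]]]] := IHr; exists H, e, hH.
by rewrite big_cons Pi; split=> // L h A A0; rewrite big_cons Pi EH.
Qed.

Lemma representsX a F m : represents a F ->
  represents (a ^+ m) (fun L h A => F L h A ^+ m).
Proof.
move=> aF; elim: m => [|m IHm].
  have [H [e [hH [E EH]]]] := represents1; exists H, e, hH.
  by rewrite expr0; split=> // L h A A0; rewrite expr0 EH.
have [H [e [hH [E EH]]]] := representsM aF IHm; exists H, e, hH.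
by rewrite exprS; split=> // L h A A0; rewrite exprS EH.
Qed.

Lemma represents_det m (a : 'M[O]_m) (F : 'I_m -> 'I_m -> point_fun) :
  (forall i j, represents (a i j) (F i j)) ->
  represents (\det a) (fun L h A => \det (\matrix_(i, j) F i j L h A)).
Proof.
move=> aF; have : represents (\det a) (fun L h A =>
    \sum_(s : 'S_m) (if odd_perm s then -1 else 1) * \prod_i F i (s i) L h A).
  apply: represents_sum => s _; apply: representsM.
    case: (odd_perm s); last by rewrite expr0; apply: represents1.
    by rewrite expr1; apply: representsN represents1.
  by apply: represents_prod.
move=> [H [e [hH [E EH]]]]; exists H, e, hH; split=> // L h A A0; rewrite EH //.
congr (_ * _); apply: eq_bigr => s _; congr (_ * _).
  by case: (odd_perm s).
by apply: eq_bigr => i _; rewrite mxE.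
Qed.

End Germs.

(** * Orders along curves through e^v *)

Section Curve.
Variables (k K : fieldType) (d n : nat) (v w : Idn d n) (iota : {rmorphism k -> K}).
Hypothesis K_infinite : forall s : seq K, exists a, a \notin s.
Variable x : 'M[K]_n.
Hypothesis x_orbit : orbit_point v w x.
Local Open Scope ring_scope.
Local Notation S := (plucker_poly k d n).
Local Notation O := (local_ring k v w).
Local Notation germ := (@germ k d n v w).
Local Notation num f := (val f).1.
Local Notation den f := (val f).2.

Lemma ev_ext (R : comNzRingType) (h h' : {rmorphism k -> R}) A (P : S) :
  h =1 h' -> ev h A P = ev h' A P.
Proof. by move=> hh; apply: eq_bigr => m _; rewrite hh. Qed.

(* [P] restricted to the curve [t |-> t x], which lies on [X_w] and passes through
   [e^v] at [t = 0]. *)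
Definition curve (P : S) : {poly K} :=
  ev (polyC \o iota) (chart_mx v ('X *: map_mx polyC x)) P.

Lemma horner_curve P a : (curve P).[a] = ev iota (chart_mx v (a *: x)) P.
Proof.
rewrite -[LHS]/(horner_eval a _) ev_morph.
rewrite (@ev_ext _ _ iota); last by move=> c; rewrite /= /horner_eval hornerC.
congr (ev _ _ _); apply/matrixP => r j; rewrite !mxE /=.
case: ifP => _; first by rewrite rmorph_nat.
by rewrite /horner_eval hornerM hornerX hornerC.
Qed.

Lemma curveM P Q : curve (P * Q) = curve P * curve Q. Proof. exact: evM. Qed.
Lemma curveD P Q : curve (P + Q) = curve P + curve Q. Proof. exact: evD. Qed.

Lemma curve_at0 P : (curve P).[0] = iota (ev idfun (coord_mx k v) P).
Proof.
rewrite horner_curve scale0r ev_morph (@ev_ext _ iota (iota \o idfun)) //.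
congr (ev _ _ _); apply/matrixP => r j; rewrite !mxE rmorph_nat.
by case: ifP => // rv; case: eqP rv => // ->; rewrite elt_in.
Qed.

(** For [a != 0] the point [a *: x] is again in the orbit, so the polynomial has infinitely many
    roots. *)
Lemma curve_vanish P : (forall (L : fieldType) (h : {rmorphism k -> L}) A,
    orbit_matrix w A -> ev h A P = 0) -> curve P = 0.
Proof.
move=> P0; apply: (poly_eq0_cofinite K_infinite (bad := [:: 0])) => a.
rewrite inE => a0; rewrite horner_curve; apply: P0.
exact/orbit_point_matrix/orbit_point_scale.
Qed.

Definition order_ge m (a : O) : Prop :=
  exists f, a = germ f /\ 'X^m %| curve (num f).

(** The order does not depend on the fraction: [s] and the denominators are nonzero at [e^v], so
    along the curve [s] can be cancelled and the denominators are coprime to ['X]. *)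
Lemma order_ge_num m f : order_ge m (germ f) -> 'X^m %| curve (num f).
Proof.
move=> [g [/ev_germ_eq[s [s0 van]] Xg]].
have := curve_vanish van; rewrite curveM => /eqP; rewrite mulf_eq0 => /orP[/eqP cs|].
  have := curve_at0 s; rewrite cs horner0 => /esym/eqP.
  by rewrite fmorph_eq0 (negPf s0).
rewrite /curve evB -!/(curve _) !curveM subr_eq0 => /eqP E.
have [e [_ _ g0]] := fractionP g.
have cop : coprimep 'X^m (curve (den g)).
  apply: coprimep_expl; rewrite coprimep_sym.
  have := coprimep_XsubC (curve (den g)) 0; rewrite subr0 => ->.
  by rewrite /root curve_at0 fmorph_eq0.
by rewrite -(Gauss_dvdpl _ cop) E dvdp_mulr.
Qed.

Lemma order_ge0 a : order_ge 0 a.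
Proof. by have [f ->] := germP a; exists f; rewrite expr0 dvd1p. Qed.

Lemma order_geD m a b : order_ge m a -> order_ge m b -> order_ge m (a + b).
Proof.
move=> [f [-> Xf]] [g [-> Xg]]; exists (fraction_add f g); rewrite germD; split=> //.
by rewrite /= curveD !curveM dvdp_add // dvdp_mulr.
Qed.

Lemma order_geM m m' a b :
  order_ge m a -> order_ge m' b -> order_ge (m + m') (a * b).
Proof.
move=> [f [-> Xf]] [g [-> Xg]]; exists (fraction_mul f g); rewrite germM; split=> //.
by rewrite /= curveM exprD dvdp_mul.
Qed.

Lemma curve_dvdX P : ('X %| curve P) = (ev idfun (coord_mx k v) P == 0).
Proof.
have := dvdp_XsubCl (curve P) 0; rewrite subr0 => ->.
by rewrite /root curve_at0 fmorph_eq0.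
Qed.

Lemma order_ge1_1 : ~ order_ge 1 1.
Proof.
move/order_ge_num; rewrite expr1 curve_dvdX /= ev1; apply/negP; exact: oner_neq0.
Qed.

Lemma order_ge_sum m (T : eqType) (s : seq T) (F : T -> O) :
  (forall i, i \in s -> order_ge m (F i)) -> order_ge m (\sum_(i <- s) F i).
Proof.
move=> HF; rewrite big_seq; apply: big_ind => //; last by move=> ? ?; apply: order_geD.
by exists (fraction_zero k v); split=> //=; rewrite /curve ev0 dvdp0.
Qed.
End Curve.

(** * Nonunits as the germs that vanish at [e^v] *)

Section MaximalIdeal.
Variables (k : fieldType) (d n : nat) (v w : Idn d n).
Hypothesis hvw : set_le v w.
Local Open Scope ring_scope.
Local Notation S := (plucker_poly k d n).
Local Notation O := (local_ring k v w).
Local Notation germ := (@germ k d n v w).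
Local Notation num f := (val f).1.
Local Notation den f := (val f).2.

(** An extension of [k] that is infinite even when [k] is finite. *)
Definition func_field := {fraction {poly k}}.
Definition const : {rmorphism k -> func_field} :=
  (@FracField.tofrac {poly k}) \o polyC.

Lemma func_field_infinite (s : seq func_field) : exists a, a \notin s.
Proof.
apply: contrapT => H.
have Hs a : a \in s by apply: contrapT => /negP a_s; apply: H; exists a.
pose t := [seq (FracField.tofrac ('X^i : {poly k})) | i <- iota 0 (size s).+1].
have ut : uniq t.
  rewrite map_inj_uniq ?iota_uniq // => i j /eqP; rewrite tofrac_eq => /eqP E.
  by have := congr1 (fun p : {poly k} => size p) E; rewrite !size_polyXn => -[].
have := uniq_leq_size ut (fun a _ => Hs a).
by rewrite size_map size_iota ltnn.
Qed.

(** Otherwise the relation [1 = 0] would hold vacuously on the orbit, against the independence of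
    the empty monomial, which is dominated because [v <= w]. *)
Lemma orbit_point_exists : exists x : 'M[func_field]_n, orbit_point v w x.
Proof.
apply: contrapT => H.
have dvw : #|(v : {set 'I_n})| = #|(w : {set 'I_n})| by rewrite !card_Idn.
have := @dominated_independent n func_field func_field_infinite v w dvw.
move=> /(_ unit [:: tt] (fun=> [ffun=> 0%N]) (fun=> 1)) H1.
have /eqP : (1 : func_field) = 0.
  apply: (H1 _ _ _ _ tt) => //.
  - by move=> [] [].
  - move=> _ _; split; first by apply/subsetP => b; rewrite inE ffunE.
    move=> l [_ _ _|b s _ /= /andP[]]; last by rewrite inE ffunE.
    by rewrite add0n; apply/set_leP.
  - by move=> x xP; case: H; exists x.
by rewrite oner_eq0.
Qed.

Local Notation M := (@nonunits O).

(** A germ nonzero at [e^v] is inverted by exchanging numerator and denominator. If a germ vanishing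
    there had an inverse, 1 would have positive order along a curve. *)
Lemma nonunit_value f : M (germ f) <-> ev idfun (coord_mx k v) (num f) = 0.
Proof.
have [e [nf df d0]] := fractionP f; split=> [Mf|n0].
  apply/eqP; apply: contraT => n0; case: Mf.
  exists (germ (exist (is_fraction v) _ (is_fraction_homog df nf n0))).
  rewrite germM germ_one; apply: germ_eq_ev => L h A _ _ /=.
  by rewrite !evM !ev1; ring.
move=> [y fy].
have [x xP] := orbit_point_exists.
apply: (order_ge1_1 (iota := const) func_field_infinite xP); rewrite -fy -[1%N]addn0.
apply: order_geM; last exact: order_ge0.
by exists f; split=> //; rewrite expr1 curve_dvdX n0 eqxx.
Qed.

Lemma nonunit_order x a : orbit_point v w x -> M a -> order_ge const x 1 a.
Proof.
move=> xP; have [f ->] := germP a => /nonunit_value f0; exists f; split=> //.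
by rewrite expr1 curve_dvdX f0 eqxx.
Qed.

Lemma ideal_pow_order x m a : orbit_point v w x ->
  ideal_pow M m a -> order_ge const x m a.
Proof.
move=> xP; elim: m a => [|m IHm] a; first by move=> _; apply: order_ge0.
move=> [s [sM ->]]; apply: order_ge_sum => // p /sM[p1 p2].
by apply: (order_geM (m := 1)) => //; [apply: nonunit_order|apply: IHm].
Qed.

Lemma nonunitD a b : M a -> M b -> M (a + b).
Proof.
have [f ->] := germP a; have [g ->] := germP b.
move=> /nonunit_value f0 /nonunit_value g0; rewrite germD; apply/nonunit_value.
by rewrite /= evD !evM f0 g0 !mul0r addr0.
Qed.

Lemma nonunitMl a b : M b -> M (a * b).
Proof. by move=> Mb [y aby]; apply: Mb; exists (a * y); rewrite mulrCA mulrA. Qed.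
End MaximalIdeal.

(** * The maximal ideal and its powers *)

Section IdealPowers.
Variables (A : comPzRingType) (M : A -> Prop).
Local Open Scope ring_scope.
Hypothesis MMl : forall a x, M x -> M (a * x).

Lemma ideal_pow0 m : ideal_pow M m 0.
Proof. by case: m => // m; exists [::]; rewrite big_nil. Qed.

Lemma ideal_powD m a b : ideal_pow M m a -> ideal_pow M m b -> ideal_pow M m (a + b).
Proof.
case: m => // m [s [sP ->]] [t [tP ->]]; exists (s ++ t); rewrite big_cat; split=> // p.
by rewrite mem_cat => /orP[/sP|/tP].
Qed.

Lemma ideal_powMl m a b : ideal_pow M m b -> ideal_pow M m (a * b).
Proof.
case: m => // m [s [sP ->]]; exists [seq (a * p.1, p.2) | p <- s]; split.
  by move=> _ /mapP[p /sP[p1 p2] ->]; split=> //; apply: MMl.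
by rewrite big_map big_distrr; apply: eq_bigr => p _; rewrite /= mulrA.
Qed.

Lemma ideal_powN m a : ideal_pow M m a -> ideal_pow M m (- a).
Proof. by rewrite -mulN1r; apply: ideal_powMl. Qed.

Lemma ideal_powM m a b : M a -> ideal_pow M m b -> ideal_pow M m.+1 (a * b).
Proof.
move=> Ma Mb; exists [:: (a, b)]; rewrite big_seq1; split=> // p.
by rewrite inE => /eqP ->.
Qed.
End IdealPowers.

(** * The chart coordinates generate the maximal ideal *)

Section Generators.
Variables (k : fieldType) (d n : nat) (v w : Idn d n).
Hypothesis hvw : set_le v w.
Local Open Scope ring_scope.
Local Notation S := (plucker_poly k d n).
Local Notation O := (local_ring k v w).
Local Notation germ := (@germ k d n v w).
Local Notation num f := (val f).1.
Local Notation den f := (val f).2.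
Local Notation M := (@nonunits O).

Definition bracket_germ f : O := germ (chart_fraction v (bracket_pol_homog k f)).

Lemma represents_bracket f :
  represents (bracket_germ f) (fun L h A => bracket A f / bracket A (elt v)).
Proof.
have [H [e [hH [E EH]]]] := represents_homog v w (bracket_pol_homog k f).
by exists H, e, hH; split=> // L h A A0; rewrite EH // ev_bracket_pol.
Qed.

Definition coord_germ : 'M[O]_n := \matrix_(r, c) bracket_germ (replace v r c).
Local Notation X := coord_germ.

Lemma bracket_germ1 : bracket_germ (elt v) = 1.
Proof.
apply: (represents_eq (represents_bracket _) (represents1 k v w)) => L h A _ A0.
exact: divff.
Qed.

Lemma represents_coord r c : represents (X r c)
  (fun L h A => bracket A (replace v r c) / bracket A (elt v)).
Proof. by rewrite mxE; apply: represents_bracket. Qed.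

Lemma bracket_coord_out (R : comPzRingType) f i : f i \notin (v : {set 'I_n}) ->
  bracket (coord_mx R v) f = 0.
Proof.
move=> fi; rewrite /bracket (expand_det_row _ i) big1 // => j _.
rewrite !mxE (_ : (_ == _) = false) ?mul0r //.
by apply: contraNF fi => /eqP ->; apply: elt_in.
Qed.

Lemma coord_nonunit b : b \in Rset v -> M (X b.1 b.2).
Proof.
rewrite inE => /andP[rv /elt_surj[j cj]]; rewrite mxE; apply/(nonunit_value hvw).
rewrite /= ev_bracket_pol (@bracket_coord_out _ _ j) //.
by rewrite /replace cj eqxx.
Qed.

Definition coord_ideal (a : O) : Prop :=
  exists c, a = \sum_(b in Rset v) X b.1 b.2 * c b.

Lemma coord_ideal0 : coord_ideal 0.
Proof. by exists (fun=> 0); rewrite big1 // => b _; rewrite mulr0. Qed.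

Lemma coord_idealD a b : coord_ideal a -> coord_ideal b -> coord_ideal (a + b).
Proof.
move=> [c ->] [c' ->]; exists (fun b => c b + c' b); rewrite -big_split /=.
by apply: eq_bigr => r _; rewrite mulrDr.
Qed.

Lemma coord_idealMl a b : coord_ideal b -> coord_ideal (a * b).
Proof.
move=> [c ->]; exists (fun b => a * c b); rewrite big_distrr /=.
by apply: eq_bigr => r _; rewrite mulrCA.
Qed.

Lemma coord_ideal_coord b a : b \in Rset v -> coord_ideal (X b.1 b.2 * a).
Proof.
move=> bR; exists (fun b' => if b' == b then a else 0).
rewrite (bigD1 b) //= eqxx big1 ?addr0 // => b' /andP[_ /negPf ->].
by rewrite mulr0.
Qed.

(** Exchanging the row [f i] for the rows of [v] writes the minor as a combination of the
    coordinates [X (f i) (elt v j)]. *)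
Lemma bracket_coord_ideal f i : f i \notin (v : {set 'I_n}) ->
  coord_ideal (bracket_germ f).
Proof.
move=> fi.
have -> : bracket_germ f =
    \sum_j X (f i) (elt v j) * bracket_germ (update f i (elt v j)).
  apply: (represents_eq (represents_bracket f)).
    apply: represents_sum => j _.
    exact: representsM (represents_coord _ _) (represents_bracket _).
  move=> L h A _ A0 /=; rewrite (bracket_exchange f i A0) big_distrl /=.
  apply: eq_bigr => j _; rewrite bracket_replace // mulfK //.
  by rewrite mulrA.
apply: big_ind; [exact: coord_ideal0|exact: coord_idealD|move=> j _].
by apply: (coord_ideal_coord (b := (f i, elt v j))); rewrite inE fi elt_in.
Qed.

Lemma bracket_elt_ideal (u : Idn d n) : u != v -> coord_ideal (bracket_germ (elt u)).
Proof.
move=> uv; have : ~~ ((u : {set 'I_n}) \subset v).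
  apply: contra uv => uv; rewrite -(inj_eq val_inj) eqEcard uv.
  by rewrite !card_Idn leqnn.
case/subsetPn => r /elt_surj[i <-]; exact: bracket_coord_ideal.
Qed.

Lemma chart_fraction_expand (P : S) e (hP : P \is e.-homog) :
  germ (chart_fraction v hP) = \sum_(m <- msupp P)
    P@_m *: \prod_t bracket_germ (elt (enum_val t : Idn d n)) ^+ m t.
Proof.
apply: (represents_eq (represents_homog v w hP)).
  apply: represents_sum => m _; apply: representsZ; apply: represents_prod => t _.
  exact/representsX/represents_bracket.
have /dhomogP homP := hP.
move=> L h A _ A0; rewrite /ev /mmap big_distrl /= !big_seq; apply: eq_bigr => m.
move=> /homP /= <-; rewrite -mulrA; congr (_ * _).
rewrite /mmap1 mdegE -prodrXr -prodf_div; apply: eq_bigr => t _.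
by rewrite expr_div_n.
Qed.

(** The bracket of [v] is 1, so a product of brackets is either 1 or has a factor in the ideal. *)
Lemma chart_fraction_const (P : S) e (hP : P \is e.-homog) :
  exists c : k, coord_ideal (germ (chart_fraction v hP) - c *: (1 : O)).
Proof.
rewrite chart_fraction_expand; elim: (msupp P) => [|m s [c IHc]].
  by exists 0; rewrite big_nil scale0r subr0; apply: coord_ideal0.
rewrite big_cons; case: (boolP [forall t, (m t == 0%N) || (enum_val t == v)]).
  move=> /forallP mv; exists (P@_m + c).
  rewrite big1 => [|t _]; first by rewrite scalerDl opprD addrACA subrr add0r.
  case/orP: (mv t) => [/eqP ->|/eqP ->]; first by rewrite expr0.
  by rewrite bracket_germ1 expr1n.
move=> /forallPn[t]; rewrite negb_or => /andP[mt tv]; exists c.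
rewrite -addrA; apply: coord_idealD => //.
rewrite (bigD1 t) //= -(prednK (n := m t)) ?lt0n // exprS -mulrA.
by rewrite scalarAr mulrC; apply: coord_idealMl; apply: bracket_elt_ideal.
Qed.

Lemma germ_one_neq0 : (1 : O) <> 0.
Proof.
move=> E; suff : M 1 by case; exists 1; rewrite mulr1.
rewrite E germ_zero; apply/(nonunit_value hvw).
by rewrite /= ev0.
Qed.

Lemma coord_ideal_nonunit a : coord_ideal a -> M a.
Proof.
move=> [c ->]; apply: big_ind.
- by move=> [y]; rewrite mul0r => /esym; apply: germ_one_neq0.
- by move=> x y; apply: nonunitD.
- by move=> b bR; rewrite mulrC; apply: nonunitMl; apply: coord_nonunit.
Qed.

Lemma nonunit_coord_ideal a : M a -> coord_ideal a.
Proof.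
have [f ->] := germP a; have [e [nf df d0]] := fractionP f => Mf.
have hpv : bracket_pol k (elt v) ^+ e \is e.-homog.
  by rewrite -[e in e.-homog]mul1n; apply/dhomogMn/bracket_pol_homog.
have -> : germ f = germ (exist (is_fraction v) _ (is_fraction_homog hpv df d0)) *
                   germ (chart_fraction v nf).
  by rewrite germM; apply: germ_eq_ev => L h A _ _ /=; rewrite !evM; ring.
(* Modulo the ideal the germ is a constant [c]; a nonzero [c] would be a unit and yet a difference
   of nonunits. *)
apply: coord_idealMl; have [c cI] := chart_fraction_const nf.
case: (eqVneq c 0) cI => [->|c0 cI]; first by rewrite scale0r subr0.
have Mn : M (germ (chart_fraction v nf)).
  by apply/(nonunit_value hvw); move/(nonunit_value hvw): Mf.
have : M (c *: (1 : O)).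
  rewrite -[c *: (1 : O)]opprK -[- (c *: (1 : O))](addKr (germ (chart_fraction v nf))).
  rewrite opprD opprK -mulN1r -[- 1]mulr1 -mulrA mul1r.
  apply: nonunitD => //; rewrite mulN1r -mulN1r; apply: nonunitMl.
  exact: coord_ideal_nonunit.
by case; exists (c^-1 *: (1 : O)); rewrite -scalarAl -scalarAr mulr1 scalerA divff // scale1r.
Qed.

Lemma germ_const a : exists c : k, M (a - c *: (1 : O)).
Proof.
have [f ->] := germP a; have [e [nf df d0]] := fractionP f.
set p := ev idfun (coord_mx k v) (num f); set q := ev idfun (coord_mx k v) (den f) in d0.
exists (p / q); rewrite -scaleNr germ_one germZ germD; apply/(nonunit_value hvw) => /=.
by rewrite evD !evM evZ !ev1 -/p -/q mulr1 mulr1 mulNr divfK // subrr.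
Qed.

Definition spans_degree m (a : O) : Prop := exists s : seq (k * monomial n),
  (forall p, p \in s -> mon_support p.2 \subset Rset v /\ mon_degree p.2 = m) /\
  ideal_pow M m.+1 (a - \sum_(p <- s) p.1 *: mon X p.2).

Lemma spans_degreeD m a b :
  spans_degree m a -> spans_degree m b -> spans_degree m (a + b).
Proof.
move=> [s [sP sM]] [t [tP tM]]; exists (s ++ t); split.
  by move=> p; rewrite mem_cat => /orP[/sP|/tP].
by rewrite big_cat /= opprD addrACA; apply: (ideal_powD sM tM).
Qed.

Lemma spans_degree0 m : spans_degree m 0.
Proof. by exists [::]; split=> //; rewrite big_nil subr0; apply: ideal_pow0. Qed.

Definition incr (b : 'I_n * 'I_n) (T : monomial n) : monomial n :=
  [ffun b' => (T b' + (b' == b))%N].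

Lemma mon_incr (R : comPzRingType) (x : 'M[R]_n) b T :
  mon x (incr b T) = x b.1 b.2 * mon x T.
Proof.
rewrite /mon (bigD1 b) //= [in RHS](bigD1 b) //= ffunE eqxx addn1 exprS -mulrA.
congr (_ * (_ * _)); apply: eq_bigr => b' /negPf bb'.
by rewrite ffunE bb' addn0.
Qed.

Lemma degree_incr b T : mon_degree (incr b T) = (mon_degree T).+1.
Proof.
rewrite /mon_degree (bigD1 b) //= [in RHS](bigD1 b) //= ffunE eqxx addn1 addSn.
congr (_ + _).+1; apply: eq_bigr => b' /negPf bb'.
by rewrite ffunE bb' addn0.
Qed.

(** Induction on [m]. In degree 0 the germ is a constant modulo [M]; in the step, the factor in [M]
    is expanded in the coordinates, and each of these multiplies monomials of degree [m]. *)
Lemma ideal_pow_spans m a : ideal_pow M m a -> spans_degree m a.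
Proof.
have MMl := @nonunitMl k d n v w.
elim: m a => [|m IHm] a Ma.
  have [c cM] := germ_const a; exists [:: (c, [ffun=> 0%N])]; split.
    move=> p; rewrite inE => /eqP -> /=; split.
      by apply/subsetP => b; rewrite inE ffunE.
    by rewrite /mon_degree big1 // => b _; rewrite ffunE.
  rewrite big_seq1 /mon big1 => [|b _]; last by rewrite ffunE expr0.
  by rewrite -[_ - _]mulr1; apply: ideal_powM.
case: Ma => s [sP ->]; rewrite big_seq.
apply: big_ind; [exact: spans_degree0|exact: spans_degreeD|move=> p ps].
have [p1 p2] := sP p ps.
have [c ->] := nonunit_coord_ideal p1; rewrite big_distrl /=.
apply: big_ind; [exact: spans_degree0|exact: spans_degreeD|move=> b bR].
rewrite -mulrA.
have [t [tP tM]] := IHm _ (ideal_powMl MMl (c b) p2).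
exists [seq (q.1, incr b q.2) | q <- t]; split.
  move=> _ /mapP[q /tP[qR qm] ->] /=; rewrite degree_incr qm; split=> //.
  apply/subsetP => b'; rewrite inE ffunE addn_eq0 negb_and => /orP[qb'|].
    by apply: (subsetP qR); rewrite inE.
  by case: (eqVneq b' b) => [-> | _] //.
rewrite big_map /=.
have -> : \sum_(q <- t) q.1 *: mon X (incr b q.2) =
    X b.1 b.2 * \sum_(q <- t) q.1 *: mon X q.2.
  by rewrite big_distrr; apply: eq_bigr => q _; rewrite mon_incr /= scalarAr.
by rewrite -mulrBr; apply: (ideal_powM (coord_nonunit bR) tM).
Qed.

Lemma mon_ideal_pow T : mon_support T \subset Rset v ->
  ideal_pow M (mon_degree T) (mon X T).
Proof.
have MMl := @nonunitMl k d n v w.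
move=> /subsetP TR; rewrite /mon /mon_degree.
elim: (index_enum _) => [|b s IHs]; first by rewrite !big_nil.
rewrite !big_cons; case: (eqVneq (T b) 0%N) => [->|Tb].
  by rewrite expr0 mul1r.
have bM : M (X b.1 b.2) by apply/coord_nonunit/TR; rewrite inE.
elim: (T b) => [|e IHe]; first by rewrite expr0 mul1r.
by rewrite exprS -mulrA addSn; apply: ideal_powM.
Qed.
End Generators.

(** * Straightening *)

Lemma exchange_lt x y p q : x < y -> p < q -> x * q + y * p < x * p + y * q.
Proof.
move=> xy pq; have [e ->] : exists e, y = x + e.+1 by exists (y - x).-1; lia.
have [f ->] : exists f, q = p + f.+1 by exists (q - p).-1; lia.
nia.
Qed.

Section Rearrangement.
Variables (t : nat) (a c : 'I_t -> nat).
Hypotheses (a_inc : forall i j : 'I_t, i < j -> a i < a j)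
           (c_inc : forall i j : 'I_t, i < j -> c i < c j).

(** The smallest moved point is sent to a larger one and is itself the image of a larger one. *)
Lemma perm_inversion (s : 'S_t) : s != 1%g ->
  exists i j : 'I_t, i < j /\ s j < s i.
Proof.
move=> s1; have [i0 si0] : exists i, s i != i.
  apply/existsP; apply: contraR s1; rewrite negb_exists => /forallP sid.
  by apply/eqP/permP => i; rewrite perm1; apply/eqP/negPn/sid.
case: (@arg_minnP _ i0 (fun i => s i != i) val si0) => i si min_i.
have fix_lt (j : 'I_t) : j < i -> s j = j.
  by move=> ji; apply/eqP; apply: contraTT ji => sj; rewrite -leqNgt min_i.
have lt_i (j : 'I_t) : j != i -> s j != j -> i < j.
  by move=> ji /min_i; rewrite leq_eqVlt (inj_eq val_inj) eq_sym (negPf ji).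
pose j := (s^-1)%g i; have sj : s j = i by rewrite permKV.
have ji : j != i by apply: contraNneq si => ji; rewrite -{1}ji sj.
exists i, j; rewrite sj; split; apply: lt_i => //; first by rewrite sj eq_sym.
by rewrite (inj_eq perm_inj).
Qed.

(** Undoing an inversion strictly increases the sum, so only the identity can attain the maximum. *)
Lemma rearrangement_lt (s : 'S_t) : s != 1%g ->
  \sum_i a i * c (s i) < \sum_i a i * c i.
Proof.
pose W (s : 'S_t) := \sum_i a i * c (s i).
have up (u : 'S_t) : u != 1%g -> exists u', W u < W u'.
  case/perm_inversion => i [j [ij uji]]; exists (tperm i j * u)%g.
  have ji : j != i by apply: contraTneq ij => ->; rewrite ltnn.
  rewrite /W (bigD1 i) //= (bigD1 j) //= [X in _ < X](bigD1 i) //=.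
  rewrite [X in _ < _ + X](bigD1 j) //= !permM tpermL tpermR.
  rewrite (eq_bigr (fun l => a l * c ((tperm i j * u)%g l))); last first.
    by move=> l /andP[li lj]; rewrite permM tpermD // eq_sym.
  by rewrite !addnA ltn_add2r; apply: exchange_lt; [apply: a_inc|apply: c_inc].
case: (@arg_maxnP _ 1%g predT W isT) => u _ max_u.
have u1 : u = 1%g.
  apply/eqP; apply: contraT => /up[u' lt_u].
  by have /(leq_trans lt_u) := max_u u' isT; rewrite ltnn.
move=> /up[u' lt_su]; apply: leq_trans lt_su _.
apply: leq_trans (max_u u' isT) _; rewrite u1 /W.
by apply: leq_sum => i _; rewrite perm1.
Qed.
End Rearrangement.

Section Straightening.
Variables (k : fieldType) (d n : nat) (v w : Idn d n).
Local Open Scope ring_scope.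
Local Notation O := (local_ring k v w).
Local Notation X := (@coord_germ k d n v w).

Lemma minor_germ_eq0 l t (r : 'I_t -> 'I_n) (c : 'I_t -> 'I_n) :
  (forall i, c i \in (v : {set 'I_n})) ->
  (forall i, l <= r i)%N -> (forall i, c i < l)%N ->
  (above w l < t + above v l)%N ->
  \det (\matrix_(i, j) X (r i) (c j)) = 0.
Proof.
move=> cv lr cl lt_l; have /choice[e eE] i : exists j, elt v j = c i by apply: elt_surj.
apply: (represents_eq (represents_det _) (represents0 k v w)).
  by move=> i j; rewrite mxE; apply: represents_coord.
move=> L h A oA A0 /=; rewrite -[RHS](minor_eq0 (r := r) (c := e) oA A0 lr) //.
  congr (\det _); apply/matrixP => i j; rewrite !mxE -eE bracket_replace //.
  by rewrite mulfK.
by move=> i; rewrite eE.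
Qed.

Lemma mon_add (R : comPzRingType) (x : 'M[R]_n) (F G : monomial n) :
  mon x [ffun b => F b + G b]%N = mon x F * mon x G.
Proof. by rewrite /mon -big_split; apply: eq_bigr => b _; rewrite ffunE exprD. Qed.

(** Along a chain both factors [n - b.1] and [b.2] increase, as the rearrangement inequality
    requires. *)
Definition weight (T : monomial n) : nat := (\sum_b T b * ((n - b.1) * b.2))%N.

Lemma weight_add (F G : monomial n) : weight [ffun b => F b + G b]%N = (weight F + weight G)%N.
Proof. by rewrite /weight -big_split; apply: eq_bigr => b _; rewrite ffunE mulnDl. Qed.

Lemma degree_add (F G : monomial n) :
  mon_degree ([ffun b => F b + G b]%N : monomial n) = (mon_degree F + mon_degree G)%N.
Proof. by rewrite /mon_degree -big_split; apply: eq_bigr => b _; rewrite ffunE. Qed.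

Section Transversal.
Variables (t : nat) (p : 'I_t -> 'I_n * 'I_n).

Definition points_mon : monomial n := [ffun b => (\sum_i (p i == b))%N].

Lemma sum_points (F : 'I_n * 'I_n -> nat) :
  (\sum_b points_mon b * F b = \sum_i F (p i))%N.
Proof.
under eq_bigr => b _ do rewrite ffunE big_distrl /=.
rewrite exchange_big /=; apply: eq_bigr => i _.
rewrite (bigD1 (p i)) //= eqxx mul1n big1 ?addn0 // => b.
by rewrite eq_sym => /negPf ->.
Qed.

Lemma mon_points (R : comPzRingType) (x : 'M[R]_n) :
  mon x points_mon = \prod_i x (p i).1 (p i).2.
Proof.
rewrite /mon; under eq_bigr => b _ do rewrite ffunE -prodrXr.
rewrite exchange_big /=; apply: eq_bigr => i _.
rewrite (bigD1 (p i)) //= eqxx expr1 big1 ?mulr1 // => b.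
by rewrite eq_sym => /negPf ->.
Qed.

Lemma degree_points : mon_degree points_mon = t.
Proof.
have := sum_points (fun=> 1%N); rewrite sum1_card card_ord => <-.
by apply: eq_bigr => b _; rewrite muln1.
Qed.

Lemma support_points b : b \in mon_support points_mon -> exists i, p i = b.
Proof.
rewrite inE ffunE; apply: contra_neqP => H; rewrite big1 // => i _.
by apply/eqP; rewrite eqb0; apply/eqP => pib; apply: H; exists i.
Qed.
End Transversal.

Definition spans_dominated m (a : O) : Prop := exists s : seq (k * monomial n),
  (forall p, p \in s -> [/\ mon_support p.2 \subset Rset v, mon_degree p.2 = m
     & chain_bounded v w p.2]) /\
  a = \sum_(p <- s) p.1 *: mon X p.2.

Lemma spans_dominated0 m : spans_dominated m 0.
Proof. by exists [::]; rewrite big_nil. Qed.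

Lemma spans_dominatedD m a b :
  spans_dominated m a -> spans_dominated m b -> spans_dominated m (a + b).
Proof.
move=> [s [sP ->]] [t [tP ->]]; exists (s ++ t); rewrite big_cat; split=> // p.
by rewrite mem_cat => /orP[/sP|/tP].
Qed.

Lemma spans_dominatedZ m c a : spans_dominated m a -> spans_dominated m (c *: a).
Proof.
move=> [s [sP ->]]; exists [seq (c * p.1, p.2) | p <- s]; split.
  by move=> _ /mapP[p /sP pP ->].
by rewrite big_map scaler_sumr; apply: eq_bigr => p _; rewrite scalerA.
Qed.

(* The entries of a chain that is too long form the diagonal of a vanishing
   minor; by the rearrangement inequality, the other terms of this minor have
   a smaller weight. *)
Lemma straightening T : mon_support T \subset Rset v ->
  spans_dominated (mon_degree T) (mon X T).
Proof.
have [N] := ubnP (weight T); elim: N T => // N IHN T; rewrite ltnS => leN TR.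
case: (pselect (chain_bounded v w T)) => [bT|nbT].
  exists [:: (1, T)]; rewrite big_seq1 scale1r; split=> // p.
  by rewrite inE => /eqP ->.
have [l [s [ss sT sl lt_l]]] : exists l s, [/\ sorted (@root_gt n) s,
    all (mem (mon_support T)) s, all (straddles l) s
    & (above w l < size s + above v l)%N].
  apply: contrapT => H; apply: nbT => l s ss sT sl; rewrite leqNgt; apply/negP => lt_l.
  by apply: H; exists l, s.
pose t := size s; pose q (i : 'I_t) := tnth (in_tuple s) i.
have qs i : q i \in s by apply: mem_tnth.
have qT i : q i \in mon_support T := allP sT _ (qs i).
have qR i : ((q i).1 \notin v) && ((q i).2 \in (v : {set 'I_n})).
  by have := subsetP TR _ (qT i); rewrite inE.
have q_inc (i j : 'I_t) : (i < j)%N -> root_gt (q i) (q j).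
  move=> ij; have b0 := q i; rewrite /q !(tnth_nth b0) /=.
  by apply: (sorted_ltn_nth (@root_gt_trans n)); rewrite ?inE.
have us : uniq s.
  by apply: sorted_uniq ss; [exact: root_gt_trans|move=> b; rewrite /root_gt /= ltnn].
pose p (u : 'S_t) i := ((q i).1, (q (u i)).2).
pose C u := points_mon (p u).
have p1 i : p 1%g i = q i by rewrite /p perm1 -surjective_pairing.
have leC b : (C 1%g b <= T b)%N.
  rewrite ffunE; under eq_bigr => i _ do rewrite p1.
  have -> : (\sum_i (q i == b) = count_mem b s)%N.
    rewrite -sum1_count [RHS]big_mkcond [RHS]big_tnth /=.
    by apply: eq_bigr => i _; rewrite /q; case: eqP.
  rewrite (count_uniq_mem _ us); case: (boolP (b \in s)) => // /(allP sT).
  by rewrite /= inE lt0n.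
(* The diagonal of the minor divides [T] because the chain has no repetitions, and [rest] is the
   quotient; [Tu u] has the term of the permutation [u] in place of the diagonal. *)
pose rest : monomial n := [ffun b => (T b - C 1%g b)%N].
pose Tu u : monomial n := [ffun b => (rest b + C u b)%N].
have T1 : Tu 1%g = T by apply/ffunP => b; rewrite ffunE [rest b]ffunE subnK.
have monTu u : mon X (Tu u) = mon X rest * \prod_i X (q i).1 (q (u i)).2.
  by rewrite mon_add mon_points.
have degTu u : mon_degree (Tu u) = mon_degree T.
  by rewrite -T1 !degree_add !degree_points.
have det0 : \det (\matrix_(i, j) X (q i).1 (q j).2) = 0.
  apply: (minor_germ_eq0 (l := l)) => // i.
  - by case/andP: (qR i).
  - by have /andP[] := allP sl _ (qs i).
  - by have /andP[] := allP sl _ (qs i).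
have : mon X rest * \det (\matrix_(i, j) X (q i).1 (q j).2) = 0 by rewrite det0 mulr0.
rewrite /determinant big_distrr (bigD1 1%g) //= odd_perm1 expr0 mul1r.
have -> : \prod_i (\matrix_(i, j) X (q i).1 (q j).2) i ((1%g : 'S_t) i) =
    \prod_i X (q i).1 (q ((1%g : 'S_t) i)).2 by apply: eq_bigr => i _; rewrite mxE.
rewrite -monTu T1 => /eqP; rewrite addr_eq0 => /eqP ->.
rewrite -scaleN1r; apply: spans_dominatedZ.
apply: big_ind; [exact: spans_dominated0|exact: spans_dominatedD|move=> u u1].
have -> : mon X rest * ((-1) ^+ u * \prod_i (\matrix_(i, j) X (q i).1 (q j).2) i (u i))
    = (-1) ^+ u *: mon X (Tu u).
  rewrite monTu (eq_bigr (fun i => X (q i).1 (q (u i)).2)); last first.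
    by move=> i _; rewrite mxE.
  rewrite mulrCA; case: (odd_perm u); rewrite ?expr1 ?expr0.
    by rewrite mulN1r scaleN1r.
  by rewrite mul1r scale1r.
apply: spans_dominatedZ; rewrite -(degTu u); apply: IHN.
  apply: leq_trans leN; rewrite -[in X in (_ < X)%N]T1 !weight_add ltn_add2l.
  rewrite /weight !sum_points /=.
  under [X in (_ < X)%N]eq_bigr => i _ do rewrite perm1.
  apply: (@rearrangement_lt _ (fun i => n - (q i).1)%N (fun i => (q i).2 : nat)) => //.
    move=> i j /q_inc/andP[h1 _]; have := ltn_ord (q i).1; have := ltn_ord (q j).1; lia.
  by move=> i j /q_inc/andP[_ h2].
apply/subsetP => b; rewrite inE ffunE addn_eq0 negb_and => /orP[|].
  rewrite ffunE => Tb; apply: (subsetP TR); rewrite inE.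
  by apply: contraNneq Tb => ->.
move=> Cb; have [|i <-] := @support_points _ (p u) b; first by rewrite inE.
by rewrite inE /p /=; have /andP[-> _] := qR i; have /andP[_ ->] := qR (u i).
Qed.
End Straightening.

(** * The graded pieces *)

Section GradedPiece.
Variables (k : fieldType) (d n : nat) (v w : Idn d n).
Hypothesis hvw : set_le v w.
Variable m : nat.
Local Open Scope ring_scope.
Local Notation O := (local_ring k v w).
Local Notation X := (@coord_germ k d n v w).
Local Notation M := (@nonunits O).
Local Notation N := #|Svw v w m|.

Definition multiplicities (T : {ffun 'I_n * 'I_n -> 'I_m.+1}) : monomial n :=
  [ffun b => val (T b)].

Definition basis_monomial (i : 'I_N) : monomial n := multiplicities (enum_val i).

Lemma basis_monomialP i : [/\ mon_support (basis_monomial i) \subset Rset v,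
  mon_degree (basis_monomial i) = m & chain_bounded v w (basis_monomial i)].
Proof.
have := enum_valP i; rewrite inE -/(multiplicities _) -/(basis_monomial i).
case/and3P => iR /eqP im /asboolP dom; split=> //.
exact/(dominatesP (card_Idn v) (card_Idn w) iR).
Qed.

Lemma basis_monomial_inj : injective basis_monomial.
Proof.
move=> i j /ffunP eqij; apply/enum_val_inj/ffunP => b; apply: val_inj.
by have := eqij b; rewrite !ffunE.
Qed.

Lemma basis_monomial_onto T : mon_support T \subset Rset v -> mon_degree T = m ->
  chain_bounded v w T -> exists i, basis_monomial i = T.
Proof.
move=> TR Tm bT; pose T' : {ffun 'I_n * 'I_n -> 'I_m.+1} := [ffun b => inord (T b)].
have T'E : multiplicities T' = T.
  apply/ffunP => b; rewrite !ffunE /= inordK // ltnS -Tm /mon_degree.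
  by rewrite (bigD1 b) //= leq_addr.
have T'S : T' \in Svw v w m.
  suff : [&& mon_support (multiplicities T') \subset Rset v,
      mon_degree (multiplicities T') == m & `[< dominates v w (multiplicities T') >]].
    by rewrite inE.
  rewrite T'E TR Tm eqxx /=.
  exact/asboolP/(dominatesP (card_Idn v) (card_Idn w) TR).
exists (enum_rank_in T'S T').
by rewrite /basis_monomial enum_rankK_in.
Qed.

(** Along the curve [t |-> t x] an element of [M ^ (m + 1)] has order at least [m + 1], while the
    combination restricts to a constant times [t ^ m]. So this constant is zero for every orbit
    point [x], and [dominated_independent] applies. *)
Lemma basis_independent (c : 'I_N -> k) :
  ideal_pow M m.+1 (\sum_i c i *: mon X (basis_monomial i)) -> forall i, c i = 0.
Proof.
move=> cM i; apply/eqP; rewrite -(fmorph_eq0 (const k)); apply/eqP.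
have vw : #|(v : {set 'I_n})| = #|(w : {set 'I_n})| by rewrite !card_Idn.
apply: (dominated_independent (@func_field_infinite k) vw (s := enum 'I_N)
  (M := basis_monomial) (c := fun i => const k (c i))).
- exact: enum_uniq.
- by move=> j l _ _; apply: basis_monomial_inj.
- by move=> j _; have [] := basis_monomialP j.
- move=> x xP; rewrite big_enum /=.
  have ord := ideal_pow_order hvw xP cM.
  have [H [e [hH [aE EH]]]] : represents (\sum_i c i *: mon X (basis_monomial i))
      (fun L h A => \sum_i h (c i) * \prod_b
         (bracket A (replace v b.1 b.2) / bracket A (elt v)) ^+ basis_monomial i b).
    apply: represents_sum => j _; apply: representsZ; apply: represents_prod => b _.
    exact/representsX/represents_coord.
  rewrite aE in ord; have := order_ge_num (@func_field_infinite k) xP ord.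
  (* All the monomials have degree [m], so the value at [a *: x] is [a ^+ m] times the value [f] at
     [x]. *)
  set f := \sum_i _; have -> : curve v (const k) x H = f%:P * 'X^m.
    apply/eqP; rewrite -subr_eq0; apply/eqP.
    apply: (poly_eq0_cofinite (@func_field_infinite k) (bad := [::])) => a _.
    rewrite hornerD hornerN hornerM hornerC hornerXn horner_curve.
    rewrite EH bracket_chart ?oner_neq0 // expr1n mul1r big_distrl /= -sumrB big1 //.
    move=> j _; rewrite -mulrA -mulrBr; apply/eqP; rewrite mulf_eq0; apply/orP; right.
    have [/subsetP jR jm _] := basis_monomialP j.
    have am : a ^+ mon_degree (basis_monomial j) = a ^+ m by rewrite jm.
    rewrite subr_eq0 [X in _ == X]mulrC -am -mon_scale; apply/eqP/eq_bigr => b _.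
    case: (eqVneq (basis_monomial j b) 0%N) => [->|jb]; first by rewrite !expr0.
    have : b \in Rset v by apply: jR; rewrite inE.
    rewrite inE => /andP[b1 /elt_surj[l bl]]; rewrite divr1 -bl.
    rewrite bracket_replace ?bracket_chart ?oner_neq0 // mulr1.
    by rewrite coords_chart // bl.
  case: (eqVneq f 0) => // f0.
  rewrite mul_polyC dvdpZr // dvdp_Pexp2l ?ltnn //.
  by rewrite size_polyX.
by rewrite mem_enum.
Qed.

Lemma spans_dominated_basis a : spans_dominated m a ->
  exists c : 'rV[k]_N, a = \sum_i c 0 i *: mon X (basis_monomial i).
Proof.
case=> s [sP ->]; elim: s sP => [|p s IHs] sP.
  by exists 0; rewrite big_nil big1 // => i _; rewrite mxE scale0r.
have [|c cE] := IHs; first by move=> q qs; apply: sP; rewrite inE qs orbT.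
have [pR pm pb] := sP p (mem_head _ _).
have [i iE] := basis_monomial_onto pR pm pb.
exists (c + p.1 *: delta_mx 0 i); rewrite big_cons cE -iE.
have -> : \sum_j (c + p.1 *: delta_mx 0 i) 0 j *: mon X (basis_monomial j) =
   \sum_j c 0 j *: mon X (basis_monomial j) +
   \sum_j (p.1 *: delta_mx 0 i : 'rV_N) 0 j *: mon X (basis_monomial j).
  by rewrite -big_split; apply: eq_bigr => j _; rewrite mxE scalerDl.
rewrite addrC; congr (_ + _); rewrite (bigD1 i) //= big1 => [|j ji].
  by rewrite !mxE !eqxx mulr1 addr0.
by rewrite !mxE (negPf ji) andbF mulr0 scale0r.
Qed.

Lemma spans_degree_dominated a : spans_degree m a ->
  exists b, spans_dominated m b /\ ideal_pow M m.+1 (a - b).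
Proof.
case=> s [sP sM]; exists (\sum_(p <- s) p.1 *: mon X p.2); split=> //.
rewrite big_seq; apply: big_ind; [exact: spans_dominated0|exact: spans_dominatedD|].
by move=> p /sP[pR <-]; apply: spans_dominatedZ; apply: straightening.
Qed.

(** The coefficients exist by [ideal_pow_spans] and [straightening] and are unique by
    [basis_independent]. *)
Theorem graded_piece_dim : tangent_cone_piece_dim k v w m N.
Proof.
exists (fun i => mon X (basis_monomial i)); split.
  by move=> i; have [iR <- _] := basis_monomialP i; apply: mon_ideal_pow.
move=> a /(ideal_pow_spans hvw)/spans_degree_dominated[b [/spans_dominated_basis[c ->] cM]].
exists c; split=> // c' c'M; apply/rowP => i; apply/eqP; rewrite -subr_eq0; apply/eqP.
apply: (basis_independent (c := fun i => c 0 i - c' 0 i)).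
have MMl := @nonunitMl k d n v w.
have := ideal_powD c'M (ideal_powN MMl cM).
congr (ideal_pow _ _ _); rewrite opprB addrC addrA subrK -sumrB.
by apply: eq_bigr => j _; rewrite scalerBl.
Qed.
End GradedPiece.

Theorem theorem2p1 (k : fieldType) (d n : nat) (hd : 0 < d) (hdn : d <= n)
    (v w : Idn d n) (hvw : set_le v w) (m : nat) :
  tangent_cone_piece_dim k v w m #|Svw v w m|.
Proof. exact: graded_piece_dim. Qed.
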